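(* There exist constants $c_1, c_2 > 0$ such that for all sufficiently large $n$, \[ c_1 \frac{n}{\log n} \leq g(n) \leq c_2 \frac{n \log\log n}{\log n}. \]
   Context: Graphs are finite and simple. The density of a graph $G$ on $n \geq 2$ vertices is $p = |E(G)|/\binom{n}{2}$. A full subgraph of a graph $G$ of density $p$ is an $m$-vertex subgraph $H$ of $G$ of minimum degree at least $p(m-1)$; $f(G)$ denotes the largest number of vertices in a full subgraph of $G$. A subgraph $H$ of $G$ is co-full if $V(H)$ induces a full subgraph of the complement $G^c$ of $G$ (fullness in $G^c$ being with respect to the density $1-p$ of $G^c$). Let $g(G)$ be the largest integer $m$ such that $G$ has a full subgraph with at least $m$ vertices or a co-full subgraph with at least $m$ vertices; equivalently $g(G) = \max\{f(G), f(G^c)\}$. Set $g(n) = \min\{ g(G) : |V(G)| = n \}$. *)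

(* Defs.v *)
(* MathComp world, with real logarithms from MathComp-Analysis *)
From HB Require Import structures.
From mathcomp Require Import all_boot all_order all_algebra.
From mathcomp Require Import reals exp.

Set Implicit Arguments.
Unset Strict Implicit.
Unset Printing Implicit Defensive.

Import Order.TTheory GRing.Theory Num.Theory.

Local Open Scope nat_scope.

(* Edges are the two-element sets of vertices. *)
Record sgraph (T : finType) := SGraph {
  edges : {set {set T}};
  edgesP : [forall e in edges, #|e| == 2] }.

HB.instance Definition _ (T : finType) := [isSub for @edges T].
HB.instance Definition _ (T : finType) := [Finite of sgraph T by <:].

Section Graphs.
Variable T : finType.
Implicit Types (G : sgraph T) (W : {set T}) (H : {set T} * sgraph T).

Fact compl_subproof G :
  [forall e in [set e : {set T} | #|e| == 2] :\: edges G, #|e| == 2].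
Proof. by apply/forall_inP => e; rewrite !inE => /andP[]. Qed.

Definition compl G : sgraph T := SGraph (compl_subproof G).

Fact induced_subproof G W :
  [forall e in [set e in edges G | e \subset W], #|e| == 2].
Proof.
by apply/forall_inP => e; rewrite inE => /andP[/(forall_inP (edgesP G))].
Qed.

Definition induced G W : {set T} * sgraph T := (W, SGraph (induced_subproof G W)).

Definition density G : rat := (#|edges G|%:R / 'C(#|T|, 2)%:R)%R.

Definition degree G (v : T) : nat := #|[set e in edges G | v \in e]|.

(* A subgraph is a pair (vertex set, graph); it need not be induced. *)
Definition subgraph G H : bool :=
  (edges H.2 \subset edges G) && [forall e in edges H.2, e \subset H.1].

Definition full G H : bool :=
  subgraph G H &&
  [forall v in H.1, (density G * #|H.1|.-1%:R <= (degree H.2 v)%:R)%R].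

Definition cofull G H : bool :=
  subgraph G H && full (compl G) (induced (compl G) H.1).

Definition fG G : nat := \max_(H | full G H) #|H.1|.

Definition gG G : nat :=
  \max_(m < #|T|.+1 |
        [exists H, (full G H || cofull G H) && (m <= #|H.1|)]) m.

Lemma subgraph_induced G W : subgraph G (induced G W).
Proof.
apply/andP; split; first by apply/subsetP => e; rewrite inE => /andP[].
by apply/forall_inP => e; rewrite inE => /andP[].
Qed.

Lemma full_induced G H : full G H -> full G (induced G H.1).
Proof.
case/andP => /andP[/subsetP sEG /forall_inP sEW] /forall_inP fH.
apply/andP; split; first exact: subgraph_induced.
apply/forall_inP => v vW; apply: le_trans (fH v vW) _.
rewrite ler_nat; apply: subset_leq_card; apply/subsetP => e.
by rewrite !inE => /andP[eH ->]; rewrite sEG ?sEW.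
Qed.

Lemma gGE G : gG G = maxn (fG G) (fG (compl G)).
Proof.
apply/eqP; rewrite eqn_leq; apply/andP; split.
  apply/bigmax_leqP => m /existsP[H /andP[fH mH]]; apply: leq_trans mH _.
  rewrite leq_max; case/orP: fH => [fH|/andP[_ fH]]; apply/orP; [left|right].
    exact: (leq_bigmax_cond (F := fun H => #|H.1|)).
  exact: (leq_bigmax_cond (F := fun H => #|H.1|) _ fH).
have gP H : full G H || cofull G H -> #|H.1| <= gG G.
  move=> fH; have lt : #|H.1| < #|T|.+1 by rewrite ltnS max_card.
  apply: (leq_bigmax_cond (F := @nat_of_ord _) (Ordinal lt)).
  by apply/existsP; exists H; rewrite fH /=.
rewrite geq_max; apply/andP; split; apply/bigmax_leqP => H fH.
  by apply: gP; rewrite fH.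
apply: (gP (induced G H.1)); apply/orP; right.
by rewrite /cofull subgraph_induced; apply: (full_induced fH).
Qed.

Fact empty_subproof : [forall e in (set0 : {set {set T}}), #|e| == 2].
Proof. by apply/forall_inP => e; rewrite inE. Qed.

Definition empty_graph : sgraph T := SGraph empty_subproof.

End Graphs.

(* The minimum over all graphs on n labelled vertices; the empty graph only
   witnesses that this family is nonempty. *)
Definition g (n : nat) : nat :=
  gG [arg min_(G < empty_graph 'I_n) gG G].

(* Main.v *)
Require Import Defs.
From mathcomp Require Import all_boot all_order all_algebra.
From mathcomp Require Import reals exp.
From mathcomp Require Import finfield sequences zify ring lra.

(* Lower bound.  For a graph of density p weigh the pairs of vertices by
   [adj - p] and let q(X) be the total weight inside X.  A maximizer of q within
   a set U is full and a minimizer is co-full, so both have at most g(G) vertices.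
   Four disjoint successive maximizers of q in U cannot all have q close to
   D = max |q|, since otherwise q would be too negative on their union; hence
   deleting 6 g(G) vertices multiplies D by at most 7/8.  As D is polynomially
   bounded from both sides, this can happen only O(log n) times.

   Upper bound.  Take t ~ log n blocks of Q vertices, each labelled by the pairs
   over a field of order sqrt Q = r ^ 2, and join u = (a, b) and v = (c, d) when
   [a c + b + d] lies in a set whose relative size is 1/2 plus a deviation: a
   positive multiple of 16 ^ -i inside block i, and a negative multiple of
   16 ^ -(max i j) between blocks i and j.  A second moment computation shows that
   edge counts between arbitrary sets follow these densities up to an error
   r ^ 7 = Q ^ (7/4).  Let x_i be the proportion of block i that belongs to X.  If X
   is full, then, up to small errors, each x_i is 0 or at least the sum of the
   x_j with j < i, so that the x_i sum to at most 4; if X is co-full, the block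
   maximizing x_i / 4 ^ i shows that all the x_i are small.  At least 2 Q further
   vertices, joined to all blocks with density 1/2, bring the density to 1/2 by a
   suitable choice of the edges among them.  This gives n / log n, without the
   factor log log n. *)

Set Implicit Arguments.
Unset Strict Implicit.
Unset Printing Implicit Defensive.

Import Order.TTheory GRing.Theory Num.Theory.

Local Open Scope ring_scope.

(** * Graphs and the lower bound *)


Section Adjacency.
Variable T : finType.
Implicit Types (G : sgraph T) (X : {set T}) (u v : T).

Definition adj G u v := [set u; v] \in edges G.

(** The factor [u != v] clears the diagonal, so that the row sum of a vertex of [X] over [X]
    compares its degree with [density G * #|X|.-1], the threshold in [full]. *)
Definition excess G u v : rat := (adj G u v)%:R - density G * (u != v)%:R.

Lemma adjC G u v : adj G u v = adj G v u.
Proof. by rewrite /adj setUC. Qed.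

Lemma adj_neq G u v : adj G u v -> u != v.
Proof. by move=> uv; have := forall_inP (edgesP G) _ uv; rewrite cards2; case: (u != v). Qed.

Lemma adjxx G u : adj G u u = false.
Proof. by apply/negP => /adj_neq; rewrite eqxx. Qed.

Lemma adj_compl G u v : adj (compl G) u v = (u != v) && ~~ adj G u v.
Proof. by rewrite /adj !inE cards2 andbC; case: (u != v). Qed.

Lemma excessC G u v : excess G u v = excess G v u.
Proof. by rewrite /excess adjC eq_sym. Qed.

Lemma excessxx G u : excess G u u = 0.
Proof. by rewrite /excess adjxx eqxx mulr0 subr0. Qed.

Lemma edge_pair G e v : e \in edges G -> v \in e ->
  exists2 u, u != v & e = [set v; u].
Proof.
move=> eG ve; have /cards2P[x [y [xy def_e]]] := forall_inP (edgesP G) e eG.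
move: ve; rewrite def_e !inE => /orP[]/eqP->; last by exists x; rewrite 1?setUC.
by exists y; rewrite 1?eq_sym.
Qed.

Lemma pair_inj v : injective (fun u => [set v; u]).
Proof.
move=> u w /setP eq_uw; have := eq_uw w; have := eq_uw u; rewrite !inE !eqxx !orbT.
by move/esym/orP => [/eqP->|/eqP->//]; case/orP => /eqP->.
Qed.

Lemma degree_induced G X v : v \in X ->
  degree (induced G X).2 v = (\sum_(u in X) adj G v u)%N.
Proof.
move=> vX; have -> : (\sum_(u in X) adj G v u = #|[set u in X | adj G v u]|)%N.
  by rewrite -sum1dep_card big_mkcondr; apply: eq_bigr => u _; case: adj.
rewrite /degree -(card_imset _ (@pair_inj v)).
congr #|pred_of_set _|; apply/setP => e; rewrite !inE.
apply/idP/imsetP => [/andP[/andP[eG eX] ve]|[u]].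
  have [u uv def_e] := edge_pair eG ve; exists u => //.
  by rewrite inE /adj -def_e eG andbT (subsetP eX) // def_e !inE eqxx orbT.
rewrite inE => /andP[uX vu] ->; rewrite !inE eqxx andbT; apply/andP; split=> //.
by apply/subsetP => w; rewrite !inE => /orP[]/eqP->.
Qed.

(** Both sides count the incidences of vertices with edges. *)
Lemma sum_adj G : (\sum_u \sum_v adj G u v = 2 * #|edges G|)%N.
Proof.
transitivity (\sum_u \sum_(e in edges G) (u \in e))%N.
  apply: eq_bigr => u _; rewrite -(eq_bigl _ _ (in_setT (T:=T))) -degree_induced ?inE //.
  rewrite /degree -sum1dep_card big_mkcond [RHS]big_mkcond /=.
  apply: eq_bigr => e _; rewrite !inE subsetT andbT.
  by case: (e \in edges G); case: (u \in e).
rewrite exchange_big /= mulnC -sum_nat_const; apply: eq_bigr => e eG.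
rewrite -(eqP (forall_inP (edgesP G) e eG)) -sum1_card [RHS]big_mkcond.
by apply: eq_bigr => u _; case: (u \in e).
Qed.

Lemma sum_excess G X v : v \in X ->
  \sum_(u in X) excess G v u
  = (degree (induced G X).2 v)%:R - density G * #|X|.-1%:R.
Proof.
move=> vX; rewrite degree_induced // natr_sum sumrB -mulr_sumr; congr (_ - _ * _).
rewrite -natr_sum; congr (_%:R); rewrite (cardsD1 v X) vX /= -sum1_card.
rewrite (bigD1 v) //= eqxx add0n; apply: eq_big => u; first by rewrite !inE andbC.
by case/andP=> _; rewrite eq_sym => ->.
Qed.

Lemma full_inducedP G X :
  reflect {in X, forall v, 0 <= \sum_(u in X) excess G v u}
          (full G (induced G X)).
Proof.
rewrite /full subgraph_induced /=; apply: (iffP forall_inP) => fX v vX.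
  by rewrite sum_excess // subr_ge0 fX.
by rewrite -subr_ge0 -sum_excess ?fX.
Qed.

Lemma density_compl G : (1 < #|T|)%N -> density (compl G) = 1 - density G.
Proof.
move=> T2; have C0 : 'C(#|T|, 2)%:R != 0 :> rat by rewrite pnatr_eq0 -lt0n bin_gt0.
rewrite /density cardsD; have -> : [set e : {set T} | #|e| == 2] :&: edges G = edges G.
  apply/setIidPr/subsetP => e; rewrite inE; exact: (forall_inP (edgesP G)).
rewrite card_draws natrB ?mulrBl ?divff //.
rewrite -card_draws; apply/subset_leq_card/subsetP => e; rewrite inE.
exact: (forall_inP (edgesP G)).
Qed.

(** Complementing changes the sign of the weight, so co-full sets are treated as full sets of the
    negated form. *)
Lemma excess_compl G u v : (1 < #|T|)%N -> excess (compl G) u v = - excess G u v.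
Proof.
move=> T2; rewrite /excess density_compl // adj_compl.
have := @adj_neq G u v; case: adj => [/(_ isT)->|_] /=; first by ring.
by case: (u != v) => /=; ring.
Qed.

Lemma full_compl_inducedP G X : (1 < #|T|)%N ->
  reflect {in X, forall v, \sum_(u in X) excess G v u <= 0}
          (full (compl G) (induced (compl G) X)).
Proof.
move=> T2; apply: (iffP (full_inducedP _ _)) => fX v vX; have := fX v vX;
  by rewrite (eq_bigr _ (fun u _ => excess_compl _ _ _ T2)) sumrN oppr_ge0.
Qed.

Lemma leq_fG G X : full G (induced G X) -> (#|X| <= fG G)%N.
Proof.
move=> fX; pose F (H : {set T} * sgraph T) := #|H.1|.
exact: (leq_bigmax_cond (F := F) _ fX).
Qed.

(** Induced subgraphs suffice, since inducing on the same vertices can only raise degrees. *)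
Lemma fG_leq G b : (forall X, full G (induced G X) -> (#|X| <= b)%N) ->
  (fG G <= b)%N.
Proof. by move=> le_b; apply/bigmax_leqP => H /full_induced; apply: le_b. Qed.

End Adjacency.

(** * Quadratic forms of symmetric weights and their maximizers *)

Section QuadraticForm.
Variables (T : finType) (M : T -> T -> rat).
Hypothesis MC : forall u v, M u v = M v u.
Implicit Types (U X Y Z : {set T}).

Definition qform X Y := \sum_(u in X) \sum_(v in Y) M u v.

Lemma qformC X Y : qform X Y = qform Y X.
Proof. by rewrite /qform exchange_big /=; do 2!apply: eq_bigr => ? _. Qed.

Lemma qformUr X Y Z : [disjoint Y & Z] ->
  qform X (Y :|: Z) = qform X Y + qform X Z.
Proof.
move=> dYZ; rewrite -big_split /=; apply: eq_bigr => u _.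
by rewrite -bigU //; apply: eq_bigl => v; rewrite !inE.
Qed.

Lemma qformUl X Y Z : [disjoint Y & Z] ->
  qform (Y :|: Z) X = qform Y X + qform Z X.
Proof. by move=> dYZ; rewrite qformC qformUr // !(qformC X). Qed.

Lemma qformU X Y : [disjoint X & Y] ->
  qform (X :|: Y) (X :|: Y) = qform X X + qform Y Y + 2 * qform X Y.
Proof.
by move=> dXY; rewrite qformUr // !qformUl // (qformC Y X); ring.
Qed.

Lemma qform_max U : exists2 X : {set T}, X \subset U &
  forall Y : {set T}, Y \subset U -> qform Y Y <= qform X X.
Proof.
have [X XU maxX] := Order.TotalTheory.arg_maxP (P := fun X : {set T} => X \subset U)
  (fun X => qform X X) (sub0set U).
by exists X.
Qed.

(* Four successive maximizers [X1, ..., X4]: the form on their union is the sum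
   over the six pairs minus twice the sum over the four singles, hence
   [- d <= 6 d - 8 q(X4)]. *)
Lemma qform_drop (m : nat) (d : rat) U :
    (forall X Y : {set T}, X \subset Y ->
       (forall Z : {set T}, Z \subset Y -> qform Z Z <= qform X X) -> (#|X| <= m)%N) ->
    (forall Y : {set T}, Y \subset U -> `|qform Y Y| <= d) ->
  exists U', [/\ U' \subset U, (#|U| <= #|U'| + 3 * m)%N &
    forall Y : {set T}, Y \subset U' -> qform Y Y <= 7%:R / 8%:R * d].
Proof.
move=> small bnd.
have [X1 s1 max1] := qform_max U; set U1 := U :\: X1.
have [X2 s2 max2] := qform_max U1; set U2 := U1 :\: X2.
have [X3 s3 max3] := qform_max U2; set U3 := U2 :\: X3.
have [X4 s4 max4] := qform_max U3.
have c1 := small _ _ s1 max1; have c2 := small _ _ s2 max2.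
have c3 := small _ _ s3 max3.
have sU3 : U3 \subset U2 by apply: subsetDl.
have sU2 : U2 \subset U1 by apply: subsetDl.
have sU1 : U1 \subset U by apply: subsetDl.
exists U3; split.
- by rewrite (subset_trans sU3) // (subset_trans sU2).
- have -> : #|U| = (#|X1| + #|X2| + #|X3| + #|U3|)%N.
    by rewrite -(setIidPr s1) -(setIidPr s2) -(setIidPr s3) -!addnA !cardsID.
  lia.
move=> Y /max4/le_trans; apply.
have s42 := subset_trans s4 sU3; have s41 := subset_trans s42 sU2.
have s31 := subset_trans s3 sU2.
have s4U := subset_trans s41 sU1; have s3U := subset_trans s31 sU1.
have s2U := subset_trans s2 sU1.
have disj X Y' Z : Z \subset Y' :\: X -> [disjoint X & Z].
  by rewrite subsetD disjoint_sym => /andP[].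
have d12 := disj _ _ _ s2; have d13 := disj _ _ _ s31; have d14 := disj _ _ _ s41.
have d23 := disj _ _ _ s3; have d24 := disj _ _ _ s42; have d34 := disj _ _ _ s4.
have sU X Z : X \subset U -> Z \subset U -> X :|: Z \subset U by rewrite subUset => ->.
have l24 := max2 _ s41; have l34 := max3 _ s42; have l14 := max1 _ s4U.
have /ler_normlP[_ b12] := bnd _ (sU _ _ s1 s2U).
have /ler_normlP[_ b13] := bnd _ (sU _ _ s1 s3U).
have /ler_normlP[_ b14] := bnd _ (sU _ _ s1 s4U).
have /ler_normlP[_ b23] := bnd _ (sU _ _ s2U s3U).
have /ler_normlP[_ b24] := bnd _ (sU _ _ s2U s4U).
have /ler_normlP[_ b34] := bnd _ (sU _ _ s3U s4U).
have /ler_normlP[b _] := bnd _ (sU _ _ (sU _ _ s1 s2U) (sU _ _ s3U s4U)).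
have dX X Y1 Y2 : [disjoint X & Y1] -> [disjoint X & Y2] -> [disjoint X & Y1 :|: Y2].
  by rewrite -!setI_eq0 setIUr setU_eq0 => -> ->.
have d1234 : [disjoint X1 :|: X2 & X3 :|: X4].
  by rewrite disjoint_sym dX // disjoint_sym dX.
rewrite (qformU d1234) (qformU d12) (qformU d34) qformUr // !qformUl // in b.
rewrite !qformU // in b12 b13 b14 b23 b24 b34.
lra.
Qed.

Lemma qform_setD1 X v : v \in X -> M v v = 0 ->
  qform X X = qform (X :\ v) (X :\ v) + 2 * \sum_(u in X) M v u.
Proof.
move=> vX Mvv; have dv : [disjoint [set v] & X :\ v] by rewrite disjoints1 !inE eqxx.
have q1 Z : qform [set v] Z = \sum_(u in Z) M v u by rewrite /qform big_set1.
rewrite -{1 2}(setD1K vX) (qformU dv) !q1 big_set1 Mvv add0r.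
by rewrite (big_setD1 v vX) /= Mvv add0r.
Qed.

(** The bridge from maximizers to full sets: deleting [v] lowers the form by twice its row sum, and
    a maximizer cannot gain from the deletion. *)
Lemma max_qform_sum_ge0 X Y v : M v v = 0 -> X \subset Y ->
    (forall Z : {set T}, Z \subset Y -> qform Z Z <= qform X X) -> v \in X ->
  0 <= \sum_(u in X) M v u.
Proof.
move=> Mvv XY maxX vX; have := maxX (X :\ v) (subset_trans (subsetDl _ _) XY).
by rewrite (qform_setD1 vX Mvv) lerDl pmulr_rge0.
Qed.

End QuadraticForm.

Lemma qformN (T : finType) (M : T -> T -> rat) (X Y : {set T}) :
  qform (fun u v => - M u v) X Y = - qform M X Y.
Proof. by rewrite /qform -sumrN; apply: eq_bigr => u _; rewrite sumrN. Qed.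

(** * Iterated shrinking of the excess form *)

Section LowerBound.
Variables (T : finType) (G : sgraph T).
Hypothesis T2 : (1 < #|T|)%N.
Implicit Types (X Y U : {set T}).

(** [qform_drop] is applied to the form, giving [U1], and then to the negated form inside [U1]. Each
    application deletes three extremal sets of at most [gG G] vertices, full in the first case and
    co-full in the second. *)
Lemma excess_drop (d : rat) U :
    (forall Y : {set T}, Y \subset U -> `|qform (excess G) Y Y| <= d) ->
  exists U' : {set T}, [/\ U' \subset U, (#|U| <= #|U'| + 6 * gG G)%N &
    forall Y : {set T}, Y \subset U' -> `|qform (excess G) Y Y| <= 7%:R / 8%:R * d].
Proof.
move=> bnd.
have [|U1 [sU1 cU1 bnd1]] := @qform_drop T (excess G) (@excessC _ G) (gG G) d U _ bnd.
  move=> X Y XY maxX; rewrite gGE; apply: leq_trans (leq_maxl _ _).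
  apply/leq_fG/full_inducedP => v; apply: max_qform_sum_ge0 XY maxX => //.
    exact: excessC.
  exact: excessxx.
have NC u v : - excess G u v = - excess G v u by rewrite excessC.
have bndN (Y : {set T}) : Y \subset U1 -> `|qform (fun u v => - excess G u v) Y Y| <= d.
  by move=> YU; rewrite qformN normrN bnd // (subset_trans YU).
have [|U2 [sU2 cU2 bnd2]] := @qform_drop T _ NC (gG G) d U1 _ bndN.
  move=> X Y XY maxX; rewrite gGE; apply: leq_trans (leq_maxr _ _).
  apply/leq_fG/full_compl_inducedP => // v vX; rewrite -oppr_ge0 -sumrN.
  by apply: (max_qform_sum_ge0 NC _ XY maxX) => //; rewrite excessxx oppr0.
exists U2; split; [exact: subset_trans sU1|lia|move=> Y YU2].
by rewrite ler_norml -lerNl -qformN bnd1 ?bnd2 // (subset_trans YU2).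
Qed.

Lemma density_ge0 : 0 <= density G.
Proof. by rewrite /density divr_ge0 ?ler0n. Qed.

Lemma density_le1 : density G <= 1.
Proof.
rewrite /density ler_pdivrMr ?ltr0n ?bin_gt0 // mul1r ler_nat -card_draws.
by apply/subset_leq_card/subsetP => e; rewrite inE; apply: (forall_inP (edgesP G)).
Qed.

Lemma excess_le1 u v : `|excess G u v| <= 1.
Proof.
have := density_ge0; have := density_le1; rewrite /excess.
have := @adj_neq _ G u v; case: adj => [/(_ isT)->|_] /=.
  by rewrite ler_norml; lra.
by case: (u != v) => /=; rewrite ler_norml; lra.
Qed.

Lemma excess_iter k : exists U : {set T}, (#|T| <= #|U| + 6 * k * gG G)%N /\
  forall Y : {set T}, Y \subset U ->
    `|qform (excess G) Y Y| <= (7%:R / 8%:R) ^+ k * #|T|%:R ^+ 2.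
Proof.
elim: k => [|k [U [cU bnd]]].
  exists setT; rewrite cardsT addn0; split=> // Y _; rewrite expr0 mul1r.
  have lesum (F : T -> rat) (c : rat) : 0 <= c -> (forall u, `|F u| <= c) ->
      `|\sum_(u in Y) F u| <= #|T|%:R * c.
    move=> c0 Fc; apply: le_trans (ler_norm_sum _ _ _) _.
    apply: le_trans (ler_sum _ (fun u _ => Fc u)) _.
    by rewrite sumr_const -[leLHS]mulr_natl; apply: ler_wpM2r => //; rewrite ler_nat max_card.
  rewrite expr2; apply: (lesum); first by rewrite ler0n.
  by move=> u; rewrite -[X in _ <= X]mulr1; apply: (lesum) => // v; apply: excess_le1.
have [U' [_ cU' bnd']] := excess_drop bnd; exists U'; split; first by lia.
by move=> Y /bnd'; rewrite mulrA -exprS.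
Qed.

(** All weights have the same sign here, so the whole vertex set is full or co-full. These densities
    are set aside because [excess] has no positive lower bound for them. *)
Lemma gG_density01 : density G = 0 \/ density G = 1 -> (#|T| <= gG G)%N.
Proof.
rewrite gGE leq_max -cardsT => p01; apply/orP; case: p01 => p01; [left|right].
  apply/leq_fG/full_inducedP => v _; apply: sumr_ge0 => u _.
  by rewrite /excess p01 mul0r subr0.
apply/leq_fG/full_compl_inducedP => // v _; apply: sumr_le0 => u _.
by rewrite /excess p01 mul1r subr_le0 ler_nat; have := @adj_neq _ G v u; case: adj => // ->.
Qed.

(** Multiplied by ['C(#|T|, 2)], the weight becomes [0] or ['C(#|T|, 2)] minus [#|edges G|], which
    is a nonzero integer; the binomial is at most [#|T| ^ 2]. *)
Lemma excess_lower u v : density G != 0 -> density G != 1 -> u != v ->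
  1 <= #|T|%:R ^+ 2 * `|excess G u v|.
Proof.
move=> p0 p1 uv; have C0 : 0 < 'C(#|T|, 2)%:R :> rat by rewrite ltr0n bin_gt0.
have CT : 'C(#|T|, 2)%:R <= #|T|%:R ^+ 2 :> rat.
  by rewrite -natrX ler_nat bin2 -divn2; nia.
apply: le_trans (ler_wpM2r (normr_ge0 _) CT).
rewrite -[X in X * _]gtr0_norm // -normrM /excess uv mulr1 mulrBr /density.
rewrite mulrCA divff ?lt0r_neq0 // mulr1 -natrM; set x := (_ * _)%N.
have xE : x != #|edges G|.
  apply/eqP => xE; move: p0 p1; rewrite /density -xE /x.
  by case: adj; rewrite ?muln1 ?muln0 ?mul0r ?eqxx // divff ?eqxx // lt0r_neq0.
by move: xE; rewrite neq_ltn => /orP[lt_x|lt_x]; [rewrite distrC|];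
  rewrite -natrB 1?ltnW // normr_nat ler1n subn_gt0.
Qed.

(** Six rounds at least halve the form, so 24 rounds gain a factor 16. *)
Lemma expr_7_8 l : (7%:R / 8%:R) ^+ (6 * (4 * l)) <= ((2 ^+ 4) ^+ l)^-1 :> rat.
Proof.
have h6 : (7%:R / 8%:R) ^+ 6 <= 2^-1 :> rat by lra.
have x0 : 0 <= 7%:R / 8%:R :> rat by lra.
move: (7%:R / 8%:R) x0 h6 => a a0 h6; rewrite exprM exprM -2!exprVn.
have a6 : a ^+ 6 \in Num.nneg by rewrite nnegrE exprn_ge0.
have half0 : (2^-1 : rat) \in Num.nneg by rewrite nnegrE invr_ge0.
have h24 := lerXn2r 4 a6 half0 h6.
by apply: lerXn2r h24; rewrite nnegrE exprn_ge0 -?nnegrE.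
Qed.

(* [24 (l + 1)] rounds divide the form by [2 ^ (4 (l + 1)) > n ^ 4]. *)
Lemma gG_lower : (#|T| <= 144 * (trunc_log 2 #|T|).+1 * gG G + 1)%N.
Proof.
have [p0|p0] := eqVneq (density G) 0; first by have := gG_density01 (or_introl p0); nia.
have [p1|p1] := eqVneq (density G) 1; first by have := gG_density01 (or_intror p1); nia.
have [l lE] : exists l, l = (trunc_log 2 #|T|).+1 by exists (trunc_log 2 #|T|).+1.
rewrite -lE; have [U [cU bnd]] := excess_iter (6 * (4 * l)).
(* On two surviving vertices the form is [2 * excess G u v], at least [2 / n ^ 2] in absolute value,
   whereas the rounds have brought it down to at most [1 / n ^ 2]. *)
rewrite leqNgt; apply/negP => lt_n; have /card_gt1P[u [v [uU vU uv]]] : (1 < #|U|)%N by lia.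
have := bnd [set u; v]; rewrite subUset !sub1set uU vU => /(_ isT).
have := excess_lower p0 p1 uv; have := expr_7_8 l.
have duv : [disjoint [set u] & [set v]] by rewrite disjoints1 inE.
rewrite (qformU (@excessC _ G) duv) /qform !big_set1 !excessxx !add0r normrM normr_nat.
have : #|T|%:R ^+ 4 <= (2 ^+ 4) ^+ l :> rat.
  by rewrite -!natrX ler_nat -expnM mulnC expnM leq_exp2r // lE ltnW // trunc_log_ltn.
have : 1 <= #|T|%:R :> rat by rewrite ler1n; lia.
move: ((_ / _) ^+ _) `|_| (_ ^+ l) (#|T|%:R) => y x w n n1 nw yw x1 xy.
have n40 : 0 < n ^+ 4 by rewrite exprn_gt0 // (lt_le_trans ltr01).
have yn : y * n ^+ 4 <= 1.
  by rewrite -ler_pdivlMr // div1r (le_trans yw) // lef_pV2 ?posrE // (lt_le_trans n40).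
clear -n1 x1 xy yn; nra.
Qed.

End LowerBound.

(** * Pseudo-randomness *)


(** Cauchy-Schwarz against the constant 1: the sum of the [(c * x u - S) ^ 2] is [c] times the
    difference of the two sides. *)
Lemma sqr_sum_le (I : finType) (A : {set I}) (x : I -> rat) :
  (\sum_(u in A) x u) ^+ 2 <= #|A|%:R * \sum_(u in A) x u ^+ 2.
Proof.
set S := \sum_(u in A) x u; set c := #|A|%:R.
have [A0|/set0Pn[a aA]] := eqVneq A set0.
  by rewrite /S A0 !big_set0 expr0n mulr0.
have c0 : 0 < c by rewrite /c ltr0n card_gt0; apply/set0Pn; exists a.
have : 0 <= \sum_(u in A) (c * x u - S) ^+ 2 by apply: sumr_ge0 => u _; apply: sqr_ge0.
have -> : \sum_(u in A) (c * x u - S) ^+ 2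
        = \sum_(u in A) (c ^+ 2 * x u ^+ 2 + (- (2 * c * S) * x u + S ^+ 2)).
  by apply: eq_bigr => u _; ring.
have sumZ k y : \sum_(u in A) k * y u = k * \sum_(u in A) y u by rewrite mulr_sumr.
rewrite !big_split /= sumr_const -[S ^+ 2 *+ _]mulr_natl !sumZ -/S -/c.
set s2 := \sum_(_ in _) _; have -> : c ^+ 2 * s2 + (- (2 * c * S) * S + c * S ^+ 2)
  = c * (c * s2 - S ^+ 2) by ring.
by rewrite pmulr_rge0 // subr_ge0.
Qed.

Section Mixing.
Variables (F : finFieldType) (S : {set F}).
Local Notation q := #|F|.
Implicit Types (u v w : F * F) (A B : {set F * F}).

(* [incid u v] is uniformly distributed in [v], and the pair
   [(incid u v, incid u v')] is uniformly distributed in [u] if [v.1 != v'.1]. *)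
Definition incid u v := u.1 * v.1 + u.2 + v.2.

Definition balanced (x : F) : rat := (x \in S)%:R - #|S|%:R / q%:R.

Lemma incidC u v : incid u v = incid v u.
Proof. by rewrite /incid; ring. Qed.

Lemma q_gt0 : 0 < q%:R :> rat.
Proof. by rewrite ltr0n; apply/card_gt0P; exists 0. Qed.

Lemma sum_balanced : \sum_x balanced x = 0.
Proof.
rewrite sumrB sumr_const -natr_sum -[_ / _ *+ _]mulr_natr mulfVK ?lt0r_neq0 ?q_gt0 //.
by rewrite -sum1_card [in X in _ - X]big_mkcond subrr.
Qed.

Lemma balanced_le1 x : `|balanced x| <= 1.
Proof.
have : 0 <= (#|S|%:R / q%:R : rat) <= 1.
  by rewrite divr_ge0 // ler_pdivrMr ?q_gt0 // mul1r ler_nat max_card.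
by rewrite /balanced ler_norml; case: (x \in S) => /= /andP[]; lra.
Qed.

(** Once the value [b] of [incid u v] is fixed, the value at [v'] is affine in [a] with nonzero
    slope [v'.1 - v.1]; it runs over all of [F], where [balanced] sums to zero. *)
Lemma balanced_corr v v' : v.1 != v'.1 ->
  \sum_u balanced (incid u v) * balanced (incid u v') = 0.
Proof.
move=> vv'; rewrite -(pair_bigA _ (fun a b =>
  balanced (incid (a, b) v) * balanced (incid (a, b) v'))) /=.
transitivity (\sum_a \sum_b balanced b * balanced (b + a * (v'.1 - v.1) + (v'.2 - v.2))).
  apply: eq_bigr => a _; rewrite [RHS](reindex_inj (addIr (a * v.1 + v.2))) /=.
  apply: eq_bigr => b _; congr (balanced _ * balanced _); rewrite /incid /=; ring.
rewrite exchange_big /= big1 // => b _; rewrite -mulr_sumr; apply/eqP.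
rewrite mulf_eq0; apply/orP; right; apply/eqP; rewrite -[RHS]sum_balanced.
pose f a := b + a * (v'.1 - v.1) + (v'.2 - v.2).
rewrite [RHS](reindex_inj (h := f)) // => x y /addIr/addrI/mulIf; apply.
by rewrite subr_eq0 eq_sym.
Qed.

(** After expanding the square, only pairs [v], [v'] with equal first coordinates survive; there are
    at most [q ^ 3] of them, each contributing at most [q ^ 2]. *)
Lemma mixing_row B :
  \sum_u (\sum_(v in B) balanced (incid u v)) ^+ 2 <= q%:R ^+ 5.
Proof.
have -> : \sum_u (\sum_(v in B) balanced (incid u v)) ^+ 2
  = \sum_(v in B) \sum_(v' in B) \sum_u balanced (incid u v) * balanced (incid u v').
  rewrite [RHS](eq_bigr (fun v => \sum_u \sum_(v' in B)
    balanced (incid u v) * balanced (incid u v'))); last first.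
    by move=> v _; rewrite exchange_big.
  rewrite [RHS]exchange_big /=; apply: eq_bigr => u _; rewrite expr2 mulr_suml.
  by apply: eq_bigr => v _; rewrite mulr_sumr.
have corr_le v v' : \sum_u balanced (incid u v) * balanced (incid u v') <= q%:R ^+ 2 :> rat.
  apply: (@le_trans _ _ (\sum_(u : F * F) 1)); last first.
    by rewrite sumr_const card_prod mulnn -natrX lexx.
  apply: ler_sum => u _; apply: le_trans (ler_norm _) _; rewrite normrM.
  by rewrite mulr_ile1 ?balanced_le1.
apply: (@le_trans _ _ (\sum_v \sum_v' (v.1 == v'.1)%:R * q%:R ^+ 2)).
  rewrite big_mkcond /=; apply: ler_sum => v _.
  case: ifP => _; last by apply: sumr_ge0 => v' _; rewrite mulr_ge0 ?exprn_ge0.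
  rewrite big_mkcond; apply: ler_sum => v' _.
  case: ifP => _; last by rewrite mulr_ge0 ?exprn_ge0.
  by have [_|/balanced_corr->] := eqVneq v.1 v'.1; rewrite ?mul1r ?mul0r.
rewrite -(pair_bigA _ (fun a b => \sum_v' (a == v'.1)%:R * q%:R ^+ 2)) /=.
under eq_bigr => a _ do under eq_bigr => b _ do
  rewrite -(pair_bigA _ (fun a' b' => (a == a')%:R * q%:R ^+ 2)) /=.
have -> : \sum_(a : F) \sum_(b : F) \sum_(a' : F) \sum_(b' : F) (a == a')%:R * q%:R ^+ 2
   = \sum_(a : F) \sum_(b : F) q%:R ^+ 3 :> rat.
  apply: eq_bigr => a _; apply: eq_bigr => b _; rewrite (bigD1 a) //= [X in _ + X]big1 ?addr0.
    by rewrite sumr_const eqxx mul1r -[LHS]mulr_natl -exprS.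
  by move=> a'; rewrite eq_sym => /negPf->; rewrite big1 // => ? _; rewrite mul0r.
by rewrite !sumr_const -mulrnA -[leLHS]mulr_natl natrM -expr2 -exprD lexx.
Qed.

(** Cauchy-Schwarz over [A], which has at most [q ^ 2] elements. For [q = r ^ 2] the discrepancy is
    thus at most [r ^ 7]. *)
Lemma mixing A B :
  (\sum_(u in A) \sum_(v in B) balanced (incid u v)) ^+ 2 <= q%:R ^+ 7.
Proof.
apply: le_trans (sqr_sum_le _ _) _.
have -> : q%:R ^+ 7 = q%:R ^+ 2 * q%:R ^+ 5 :> rat by rewrite -exprD.
apply: ler_pM => //; first by apply: sumr_ge0 => u _; apply: sqr_ge0.
  by rewrite -natrX ler_nat -mulnn -card_prod max_card.
apply: le_trans (mixing_row B); rewrite big_mkcond; apply: ler_sum => u _.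
by case: ifP => // _; apply: sqr_ge0.
Qed.

End Mixing.

(** * Block weights *)


Section Weights.
Variables (R : realFieldType) (t : nat) (x : nat -> R) (e : R).
Hypothesis x_ge0 : forall i, 0 <= x i.
Hypothesis x_le1 : forall i, x i <= 1.
Hypothesis e_ge0 : 0 <= e.

(** These are the deviations [16 ^ -i] scaled by [16 ^ t], so that integer shifts of a threshold can
    realize them. *)
Definition weight (i j : nat) : R :=
  if i == j then 16%:R ^+ (t - i) else - 16%:R ^+ (t - maxn i j).

Definition weighted_row i := \sum_(0 <= j < t) weight i j * x j.

(** For [j < i] the entry has the absolute value of the diagonal one, as [maxn i j = i]; this is
    what compares [x i] with the sum of all earlier [x j]. *)
Lemma weighted_rowE i : (i < t)%N -> weighted_row i =
  16%:R ^+ (t - i) * (x i - \sum_(0 <= j < i) x j)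
  - \sum_(i.+1 <= j < t) 16%:R ^+ (t - j) * x j.
Proof.
move=> it; rewrite /weighted_row (@big_cat_nat _ _ _ i) //=; last exact: ltnW.
rewrite (big_ltn it) /weight eqxx mulrBr mulr_sumr -!sumrN addrA; congr (_ + _).
  rewrite addrC; congr (_ + _); apply: eq_big_nat => j /andP[_ ji].
  by rewrite gtn_eqF // (maxn_idPl (ltnW ji)) mulNr.
apply: eq_big_nat => j /andP[ij _].
by rewrite ltn_eqF // (maxn_idPr (ltnW ij)) mulNr.
Qed.

(** While the partial sum [s] is at most 2, adding [x m <= 1] keeps it at most 3. Once [s > 2], the
    factor [s - x m] exceeds 1, which forces [x m <= e]. The at most [t] increments [e] add up to at
    most 1. *)
Lemma weighted_row_full : e * t%:R <= 1 ->
    (forall i, (i < t)%N -> - e <= x i * weighted_row i) ->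
  \sum_(0 <= i < t) x i <= 4%:R.
Proof.
move=> et1 row_ge; suff S_le m : (m <= t)%N -> \sum_(0 <= i < m) x i <= 3%:R + e * m%:R.
  by have := S_le t (leqnn t); lra.
elim: m => [|m IHm] mt; first by rewrite big_geq // mulr0 addr0.
pose s : R := \sum_(0 <= i < m) x i; have {IHm} s_le : s <= _ := IHm (ltnW mt).
have -> : \sum_(0 <= i < m.+1) x i = s + x m by rewrite big_nat_recr.
have s_ge0 : 0 <= s by apply: sumr_ge0.
(* If [x m < s], the row is at most [x m - s]: its power of 16 is at least 1 and the later blocks
   only lower it. *)
have xs : - e <= x m * (x m - s).
  have [xs0|xs0] := lerP 0 (x m - s).
    by apply: le_trans (mulr_ge0 (x_ge0 _) xs0); rewrite oppr_le0.
  apply: le_trans (row_ge m mt) _; rewrite weighted_rowE // -/s.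
  set w := \sum_(_ <= _ < _) _; have w0 : 0 <= w.
    by apply: sumr_ge0 => j _; rewrite mulr_ge0 ?exprn_ge0.
  apply: ler_wpM2l => //; have : 1 <= 16%:R ^+ (t - m) :> R by rewrite exprn_ege1 ?ler1n.
  move: (_ ^+ _) => c c1.
  have : 0 <= (c - 1) * (s - x m) by apply: mulr_ge0; lra.
  by lra.
have xm1 := x_le1 m; have xm0 := x_ge0 m; have e0 := e_ge0.
have em : 0 <= e * m%:R by rewrite mulr_ge0.
have -> : e * m.+1%:R = e * m%:R + e by rewrite -natr1 mulrDr mulr1.
have [s2|s2] := lerP s 2; first by lra.
have : x m * 1 <= x m * (s - x m) by apply: ler_wpM2l => //; lra.
by lra.
Qed.

Lemma geom4 i : 3%:R * (\sum_(0 <= j < i) 4%:R ^+ j) <= 4%:R ^+ i :> R.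
Proof.
suff : 3%:R * (\sum_(0 <= j < i) 4%:R ^+ j) + 1 <= 4%:R ^+ i :> R by lra.
elim: i => [|i IHi]; first by rewrite big_geq // mulr0 add0r.
by rewrite big_nat_recr //= exprS; lra.
Qed.

(** Consecutive terms have ratio 1/4. The extra term at [m] in the generalization stands for the
    remaining tail. *)
Lemma geom16 i : (i < t)%N ->
  3%:R * (\sum_(i.+1 <= j < t) 16%:R ^+ (t - j) * 4%:R ^+ j)
    <= 16%:R ^+ (t - i) * 4%:R ^+ i :> R.
Proof.
move=> it; suff /(_ t it (leqnn t)) : forall m, (i < m)%N -> (m <= t)%N ->
  3%:R * (\sum_(i.+1 <= j < m) 16%:R ^+ (t - j) * 4%:R ^+ j) + 4%:R * (16%:R ^+ (t - m) * 4%:R ^+ m)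
    <= 16%:R ^+ (t - i) * 4%:R ^+ i :> R.
  have : 0 <= 16%:R ^+ (t - t) * 4%:R ^+ t :> R by rewrite mulr_ge0 ?exprn_ge0.
  by lra.
elim=> // m IHm; rewrite ltnS leq_eqVlt => /orP[/eqP<- _|im mt].
  by rewrite big_geq // mulr0 add0r -(subnSK it) !exprS; lra.
have := IHm im (ltnW mt); rewrite big_nat_recr //= -(subnSK mt) !exprS.
by lra.
Qed.

(* Apply the hypothesis to the [i] maximizing [x i / 4 ^ i]. *)
Lemma weighted_row_cofull : e * (3 * t ^ 2 * 16 ^ t)%:R <= 1 ->
    (forall i, (i < t)%N -> x i * weighted_row i <= e) ->
  \sum_(0 <= i < t) x i <= 4%:R.
Proof.
move=> et1 row_le; have [t0|t_gt0] := posnP t; first by rewrite t0 big_geq.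
pose yf (i : 'I_t) := x i / 4%:R ^+ i.
case: (Order.TotalTheory.arg_maxP (i0 := Ordinal t_gt0) (P := xpredT) yf isT) => i _ max_i.
pose y := x i / 4%:R ^+ i; have y0 : 0 <= y by rewrite divr_ge0 ?exprn_ge0.
have p4 j : 0 < 4%:R ^+ j :> R by rewrite exprn_gt0.
have xi : x i = y * 4%:R ^+ i by rewrite mulfVK ?lt0r_neq0.
have xj j : (j < t)%N -> x j <= y * 4%:R ^+ j.
  by move=> jt; rewrite -ler_pdivrMr //; apply: (max_i (Ordinal jt) isT).
have s1 : \sum_(0 <= j < i) x j <= y * \sum_(0 <= j < i) 4%:R ^+ j.
  rewrite mulr_sumr; apply: ler_sum_nat => j /andP[_ ji].
  by apply: xj; apply: ltn_trans (ltn_ord i).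
have s2 : \sum_(i.+1 <= j < t) 16%:R ^+ (t - j) * x j
    <= y * \sum_(i.+1 <= j < t) 16%:R ^+ (t - j) * 4%:R ^+ j.
  rewrite mulr_sumr; apply: ler_sum_nat => j /andP[_ jt].
  by rewrite mulrCA ler_wpM2l ?exprn_ge0 ?xj.
have g1 := geom4 i; have g2 := geom16 (ltn_ord i).
have := row_le i (ltn_ord i); rewrite weighted_rowE //.
have xi0 := x_ge0 i.
have c1 : 1 <= 16%:R ^+ (t - i) :> R by rewrite exprn_ege1 ?ler1n.
(* Earlier and later blocks each cost at most a third of the diagonal term, by [geom4] and [geom16],
   so a third of it remains. *)
have key : x i * (16%:R ^+ (t - i) * x i) <= 3%:R * (x i *
   (16%:R ^+ (t - i) * (x i - \sum_(0 <= j < i) x j)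
    - \sum_(i.+1 <= j < t) 16%:R ^+ (t - j) * x j)).
  rewrite [leRHS]mulrCA; apply: ler_wpM2l => //.
  have gen (a b c d S1 S2 : R) : S1 <= y * a -> S2 <= y * b -> 3%:R * a <= d ->
      3%:R * b <= c * d -> 1 <= c -> c * (y * d) <= 3%:R * (c * (y * d - S1) - S2).
    move=> h1 h2 h3 h4 h5; have k1 : y * (3%:R * a) <= y * d by apply: ler_wpM2l.
    have k2 : y * (3%:R * b) <= y * (c * d) by apply: ler_wpM2l.
    have k3 : c * S1 <= c * (y * a) by apply: ler_wpM2l => //; lra.
    have k4 : c * (y * (3%:R * a)) <= c * (y * d) by apply: ler_wpM2l => //; lra.
    by lra.
  by rewrite xi; apply: gen s1 s2 g1 g2 c1.
move=> row; have xi2 : x i ^+ 2 <= 3%:R * e.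
  apply: le_trans (le_trans key _); last by rewrite ler_wpM2l.
  by rewrite mulrCA ler_peMl // sqr_ge0.
(* Every [x j] is at most [4 ^ t * x i]; squaring and using [xi2] produces the factor
   [3 * t ^ 2 * 16 ^ t] of the hypothesis. *)
have sum_le : \sum_(0 <= j < t) x j <= t%:R * (4%:R ^+ t * x i).
  rewrite -[t in t%:R * _](card_ord t) mulr_natl -sumr_const big_mkord.
  apply: ler_sum => j _; apply: le_trans (xj j (ltn_ord j)) _.
  rewrite mulrC; apply: ler_pM => //; first exact: exprn_ge0.
    by rewrite ler_weXn2l ?ler1n // ltnW.
  by rewrite /y ler_pdivrMr // ler_peMr // exprn_ege1 ?ler1n.
apply: le_trans sum_le _; rewrite -(@ler_pXn2r _ 2) ?nnegrE ?mulr_ge0 ?exprn_ge0 //.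
have c16 : (4%:R ^+ t) ^+ 2 = 16%:R ^+ t :> R.
  by rewrite -exprM mulnC exprM -natrX.
rewrite !exprMn c16; move: et1; rewrite !natrM !natrX.
set c := 16%:R ^+ t; have : 0 <= t%:R ^+ 2 * c :> R by rewrite mulr_ge0 ?exprn_ge0.
move=> d0 et1; have : t%:R ^+ 2 * c * x i ^+ 2 <= t%:R ^+ 2 * c * (3%:R * e).
  exact: ler_wpM2l.
by lra.
Qed.

End Weights.

(** * The construction *)


Section GraphOf.
Variable T : finType.

Fact graph_of_subproof (a : rel T) :
  [forall e in [set e : {set T} | (#|e| == 2) &&
    [forall u in e, forall v in e, (u != v) ==> a u v]], #|e| == 2].
Proof. by apply/forall_inP => e; rewrite inE => /andP[]. Qed.

Definition graph_of (a : rel T) : sgraph T := SGraph (graph_of_subproof a).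

Lemma adj_graph_of (a : rel T) u v : symmetric a ->
  adj (graph_of a) u v = (u != v) && a u v.
Proof.
move=> symA; rewrite /adj inE cards2; case: (eqVneq u v) => //= uv.
apply/forall_inP/idP => [/(_ u)|auv x].
  rewrite !inE eqxx => /(_ isT)/forall_inP/(_ v).
  by rewrite !inE eqxx orbT uv; apply.
rewrite !inE => /orP[]/eqP->; apply/forall_inP => z; rewrite !inE => /orP[]/eqP->;
  by rewrite ?eqxx ?auv ?implybT // symA auv implybT.
Qed.

Definition take_set (A : {set T}) k : {set T} := [set x in take k (enum A)].

Lemma take_set_sub A k : take_set A k \subset A.
Proof. by apply/subsetP => x; rewrite inE => /mem_take; rewrite mem_enum. Qed.

Lemma card_take_set (A : {set T}) k : (k <= #|A|)%N -> #|take_set A k| = k.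
Proof.
move=> kA; rewrite cardsE; have /card_uniqP-> := take_uniq k (enum_uniq (mem A)).
by rewrite size_takel // -cardE.
Qed.

End GraphOf.

(** Since [2 * k + 1] pairs have maximum [k], the sum is geometric up to a linear factor, which the
    surplus [3 * m + 2] absorbs in the induction. *)
Lemma sum_weight (m : nat) :
  \sum_(0 <= i < m) \sum_(0 <= j < m) 16%:R ^+ (m - maxn i j) <= 2%:R * 16%:R ^+ m :> rat.
Proof.
suff : \sum_(0 <= i < m) \sum_(0 <= j < m) 16%:R ^+ (m - maxn i j) + (3 * m + 2)%:R
    <= 2%:R * 16%:R ^+ m :> rat by apply: le_trans; rewrite lerDl ler0n.
elim: m => [|m IHm]; first by rewrite big_geq.
have split_last : \sum_(0 <= i < m.+1) \sum_(0 <= j < m.+1) 16%:R ^+ (m.+1 - maxn i j)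
    = 16%:R * (\sum_(0 <= i < m) \sum_(0 <= j < m) 16%:R ^+ (m - maxn i j))
      + 16%:R * (2 * m + 1)%:R :> rat.
  have row i : (i < m)%N -> \sum_(0 <= j < m.+1) 16%:R ^+ (m.+1 - maxn i j)
     = 16%:R * (\sum_(0 <= j < m) 16%:R ^+ (m - maxn i j)) + 16%:R :> rat.
    move=> im; rewrite big_nat_recr //= (maxn_idPr (ltnW im)) subSnn expr1.
    congr (_ + _); rewrite mulr_sumr; apply: eq_big_nat => j /andP[_ jm].
    by rewrite subSn ?exprS // geq_max (ltnW im) (ltnW jm).
  rewrite big_nat_recr //= (eq_big_nat _ _ (F2 := fun i =>
    16%:R * (\sum_(0 <= j < m) 16%:R ^+ (m - maxn i j)) + 16%:R)); last first.
    by move=> i /andP[_ im]; apply: row.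
  rewrite big_split /= -mulr_sumr sumr_const_nat subn0 -addrA; congr (_ + _).
  rewrite (eq_big_nat _ _ (F2 := fun=> 16%:R)) => [|j /andP[_ jm]]; last first.
    by rewrite (maxn_idPl _) // subSnn.
  by rewrite sumr_const_nat subn0 -!mulrnA -!natrM -natrD; congr (_%:R); lia.
move: IHm; rewrite split_last exprS; move: (\sum_(_ <= _ < _) _) (16%:R ^+ m) => a b.
rewrite (_ : (3 * m.+1 + 2)%N = (3 * m + 5)%N) ?natrD ?natrM; last by lia.
have : 0 <= m%:R :> rat by []. move: (m%:R : rat) => z z0; lra.
Qed.

Section Construction.
Variables (V : finType) (F : finFieldType) (t y : nat).
Variables (blk : V -> nat) (lab : V -> F * F).
(** This choice keeps all deviations [16 ^ i * (y / r)] with [i <= t] within 1/4, while a large [y]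
    makes the error [(t + 4) / y] small. *)
Local Notation r := (4 * 16 ^ t * y)%N.
Hypothesis cardF : #|F| = (r ^ 2)%N.
Hypothesis blk_lt : forall u, (blk u < t + 3)%N.
Hypothesis blk_lab : forall u v, blk u = blk v -> lab u = lab v -> u = v.
Hypothesis y_ge : (8 * (t + 4) ^ 3 * 16 ^ t <= y)%N.
Hypothesis V_ge : ((t + 2) * r ^ 4 <= #|V|)%N.
Implicit Types (X Y : {set V}) (u v : V).

(** In a field of order [r ^ 2], a shift by a multiple of [r * y] changes the density by the same
    multiple of [y / r]. Indices from [t] on are the further blocks. *)
Definition threshold i j : nat :=
  if (maxn i j < t)%N then
    if i == j then (#|F|./2 + 16 ^ (t - maxn i j) * (r * y))%N
    else (#|F|./2 - 16 ^ (t - maxn i j) * (r * y))%N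
  else #|F|./2.

Definition core u v : bool :=
  incid (lab u) (lab v) \in take_set setT (threshold (blk u) (blk v)).

Definition part X i : {set V} := [set u in X | blk u == i].

Definition mu i j : rat := if (maxn i j < t)%N then weight rat t i j else 0.

Lemma y_gt0 : (0 < y)%N.
Proof. by apply: leq_trans y_ge; rewrite !muln_gt0 !expn_gt0 addn_gt0 orbT. Qed.

Lemma r_gt0 : (0 < r)%N.
Proof. by rewrite !muln_gt0 expn_gt0 y_gt0. Qed.

Lemma y_ge3 : ((t + 4) * (3 * t ^ 2 * 16 ^ t) <= y)%N.
Proof.
apply: leq_trans y_ge; rewrite !mulnA leq_mul2r; apply/orP; right.
nia.
Qed.

Lemma y_ge1 : ((t + 4) * t <= y)%N.
Proof.
apply: leq_trans y_ge3; rewrite leq_mul2l; apply/orP; right.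
have : (0 < 16 ^ t)%N by rewrite expn_gt0.
by move: (16 ^ t)%N => a; nia.
Qed.

Lemma V_gt1 : (1 < #|V|)%N.
Proof.
apply: leq_trans V_ge; rewrite -[2%N]muln1 leq_mul ?leq_addl //.
by rewrite expn_gt0 r_gt0.
Qed.

(** Makes the truncated subtraction in [threshold] exact and keeps every threshold at most
    [#|F|]. *)
Lemma bump_le m : (16 ^ (t - m) * (r * y) * 4 <= #|F|)%N.
Proof.
have h : (16 ^ (t - m) <= 16 ^ t)%N by rewrite leq_pexp2l // leq_subr.
rewrite cardF; have := leq_mul h (leqnn (r * y * 4)); rewrite !mulnA expnS expn1.
by move=> /leq_trans; apply; rewrite -!mulnA; nia.
Qed.

(** As 4 divides [r], the field has even order and density 1/2 is attained exactly. *)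
Lemma halfF : (#|F|./2 * 2 = #|F|)%N.
Proof.
rewrite cardF -mulnA; move: (16 ^ t * y)%N => a.
have -> : ((4 * a) ^ 2 = (8 * a ^ 2).*2)%N by rewrite expnMn -muln2; lia.
by rewrite doubleK muln2.
Qed.

Lemma coreC u v : core u v = core v u.
Proof. by rewrite /core incidC /threshold maxnC [blk u == _]eq_sym. Qed.

Lemma threshold_le i j : (threshold i j <= #|F|)%N.
Proof.
have := halfF; have := bump_le (maxn i j); rewrite /threshold.
by case: ifP => _ *; first case: ifP => _; lia.
Qed.

Lemma thresholdE i j :
  (threshold i j)%:R / #|F|%:R - 2^-1 = y%:R / r%:R * mu i j :> rat.
Proof.
have r0 : r%:R != 0 :> rat by rewrite pnatr_eq0 -lt0n r_gt0.
have F0 : #|F|%:R = r%:R ^+ 2 :> rat by rewrite cardF natrX.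
have F2 : (#|F|./2)%:R = #|F|%:R / 2 :> rat.
  by rewrite -[in RHS]halfF natrM mulfK.
have := halfF; have := bump_le (maxn i j); rewrite /threshold /mu /weight.
set z := (16 ^ (t - maxn i j) * _)%N => b1 b2.
have zE : z%:R = 16%:R ^+ (t - maxn i j) * (r%:R * y%:R) :> rat.
  by rewrite /z natrM (natrM _ r) natrX.
case: ifP => _; last first.
  by rewrite F2 F0 mulr0; move: (r%:R : rat) r0 => s s0; field.
case: ifP => [/eqP ij|_].
  rewrite natrD zE F2 F0 ij maxnn; move: (r%:R : rat) r0 (16%:R ^+ _) => s s0 c.
  by field.
rewrite natrB; last by lia.
by rewrite zE F2 F0; move: (r%:R : rat) r0 (16%:R ^+ _) => s s0 c; field.
Qed.

(** Labels are injective within a block, so the sum becomes one of centered indicators over two sets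
    of labels, to which [mixing] applies. *)
Lemma block_dev X Y i j :
    {in X, forall u, blk u = i} -> {in Y, forall v, blk v = j} ->
  `|\sum_(u in X) \sum_(v in Y) ((core u v)%:R - 2^-1)
    - #|X|%:R * #|Y|%:R * (y%:R / r%:R * mu i j)| <= r%:R ^+ 7 :> rat.
Proof.
move=> Xi Yj; set S := take_set [set: F] (threshold i j).
have cardS : #|S| = threshold i j by rewrite card_take_set // cardsT threshold_le.
have injX : {in X &, injective lab}.
  by move=> u v uX vX; apply: blk_lab; rewrite !Xi.
have injY : {in Y &, injective lab}.
  by move=> u v uX vX; apply: blk_lab; rewrite !Yj.
have -> : \sum_(u in X) \sum_(v in Y) ((core u v)%:R - 2^-1)
    - #|X|%:R * #|Y|%:R * (y%:R / r%:R * mu i j)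
  = \sum_(a in lab @: X) \sum_(b in lab @: Y) balanced S (incid a b).
  rewrite big_imset //= -thresholdE.
  have -> : #|X|%:R * #|Y|%:R * ((threshold i j)%:R / #|F|%:R - 2^-1)
    = \sum_(u in X) \sum_(v in Y) ((threshold i j)%:R / #|F|%:R - 2^-1) :> rat.
    by rewrite !sumr_const -mulrA !mulr_natl.
  rewrite -sumrB; apply: eq_bigr => u uX; rewrite big_imset //= -sumrB.
  apply: eq_bigr => v vY; rewrite /balanced cardS /core Xi // Yj //.
  by rewrite opprB addrA subrK.
have := mixing S (lab @: X) (lab @: Y); set d := \sum_(a in _) _.
have -> : #|F|%:R ^+ 7 = (r%:R ^+ 7) ^+ 2 :> rat by rewrite cardF natrX -!exprM.
move=> d_le; rewrite -(@ler_pXn2r _ 2) ?nnegrE ?exprn_ge0 //.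
by rewrite real_normK ?num_real.
Qed.

Lemma card_part X i : (#|part X i| <= r ^ 4)%N.
Proof.
have <- : #|lab @: part X i| = #|part X i|.
  apply: card_in_imset => u v; rewrite !inE => /andP[_ /eqP ui] /andP[_ /eqP vi].
  by apply: blk_lab; rewrite ui vi.
by apply: leq_trans (max_card _) _; rewrite card_prod cardF -expnD.
Qed.

Lemma sum_part (R' : nmodType) X (f : V -> R') :
  \sum_(u in X) f u = \sum_(i < t + 3) \sum_(u in part X i) f u.
Proof.
rewrite (partition_big (fun u => Ordinal (blk_lt u)) xpredT) //=.
by apply: eq_bigr => i _; apply: eq_bigl => u; rewrite !inE -val_eqE.
Qed.

Lemma card_sum_part X : #|X| = (\sum_(i < t + 3) #|part X i|)%N.
Proof.
by rewrite -sum1_card sum_part; apply: eq_bigr => i _; rewrite sum1_card.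
Qed.

Lemma part_blk X i : {in part X i, forall u, blk u = i}.
Proof. by move=> u; rewrite inE => /andP[_ /eqP]. Qed.

Lemma big_lt_t (R' : nmodType) (f : nat -> R') : (forall j, (t <= j)%N -> f j = 0) ->
  \sum_(j < t + 3) f j = \sum_(0 <= j < t) f j.
Proof.
move=> f0; rewrite -(big_mkord xpredT) (@big_cat_nat _ _ _ t) ?leq_addr //=.
by rewrite [X in _ + X]big_nat_cond [X in _ + X]big1 ?addr0 // => j /andP[/andP[/f0]].
Qed.

Lemma row_dev X i : (i < t)%N ->
  `|\sum_(u in part X i) \sum_(v in X) ((core u v)%:R - 2^-1)
    - #|part X i|%:R * (y%:R / r%:R) *
      weighted_row t (fun j => #|part X j|%:R) i| <= (t + 3)%:R * r%:R ^+ 7 :> rat.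
Proof.
move=> it; set P := part X i.
have -> : \sum_(u in P) \sum_(v in X) ((core u v)%:R - 2^-1)
    - #|P|%:R * (y%:R / r%:R) * weighted_row t (fun j => #|part X j|%:R) i
  = \sum_(j < t + 3) (\sum_(u in P) \sum_(v in part X j) ((core u v)%:R - 2^-1)
      - #|P|%:R * #|part X j|%:R * (y%:R / r%:R * mu i j)) :> rat.
  rewrite sumrB; congr (_ - _).
    by rewrite [RHS]exchange_big /=; apply: eq_bigr => u _; rewrite sum_part.
  rewrite (big_lt_t (f := fun j => #|P|%:R * #|part X j|%:R * (y%:R / r%:R * mu i j))).
    rewrite /weighted_row mulr_sumr; apply: eq_big_nat => j /andP[_ jt].
    by rewrite /mu gtn_max it jt [weight _ _ _ _ * _]mulrC mulrACA.
  by move=> j tj; rewrite /mu gtn_max it /= ltnNge tj !mulr0.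
apply: le_trans (ler_norm_sum _ _ _) _.
apply: (@le_trans _ _ (\sum_(j < t + 3) r%:R ^+ 7)).
  by apply: ler_sum => j _; apply: block_dev; apply: part_blk.
by rewrite sumr_const card_ord -[leLHS]mulr_natl.
Qed.

(** * Full and co-full sets of graphs that follow the block pattern *)

Section Graph.
Variable G : sgraph V.
Hypothesis adjG : forall u v,
  u != v -> (blk u < t)%N || (blk v < t)%N -> adj G u v = core u v.
Hypothesis densG : `|density G - 2^-1| * #|V|%:R <= 2^-1.

Lemma excess_core u v : (blk u < t)%N ->
  excess G u v - ((core u v)%:R - 2^-1)
  = (2^-1 - density G) + (if u == v then density G - (core u u)%:R else 0).
Proof.
move=> ut; rewrite /excess; have [<-|uv] := eqVneq u v.
  by rewrite adjxx /=; ring.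
by rewrite adjG ?ut //=; ring.
Qed.

(** Each vertex causes two errors of at most 1: the distance of the density from 1/2, summed over
    [X], and a diagonal term, as [core] need not be irreflexive. *)
Lemma excess_core_sum X i : (i < t)%N ->
  `|\sum_(u in part X i) \sum_(v in X) excess G u v
    - \sum_(u in part X i) \sum_(v in X) ((core u v)%:R - 2^-1)|
    <= 2%:R * r%:R ^+ 4.
Proof.
move=> it; rewrite -sumrB; apply: le_trans (ler_norm_sum _ _ _) _.
apply: (@le_trans _ _ (\sum_(u in part X i) 2%:R)); last first.
  by rewrite sumr_const -[leLHS]mulr_natr ler_wpM2l // -natrX ler_nat card_part.
apply: ler_sum => u uP; have [uX ui] : u \in X /\ blk u = i.
  by move: uP; rewrite inE => /andP[-> /eqP].
rewrite -sumrB (eq_bigr _ (fun v _ => excess_core v _)) ?ui //.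
rewrite big_split /= sumr_const (bigD1 u) //= eqxx [X in _ + (_ + X)]big1 => [|v]; last first.
  by rewrite eq_sym => /andP[_ /negPf->].
rewrite addr0 -[_ *+ _]mulr_natr; apply: le_trans (ler_normD _ _) _.
have h1 : `|(2^-1 - density G) * #|X|%:R| <= 1.
  rewrite normrM normr_nat distrC.
  apply: le_trans (ler_wpM2l (normr_ge0 _) (_ : #|X|%:R <= #|V|%:R)) _.
    by rewrite ler_nat max_card.
  by apply: le_trans densG _; lra.
have h2 : `|density G - (core u u)%:R| <= 1.
  have := density_ge0 G; have := density_le1 G V_gt1.
  by rewrite ler_norml; case: (core u u) => /=; lra.
by lra.
Qed.

Lemma row_approx X i : (i < t)%N ->
  `|\sum_(u in part X i) \sum_(v in X) excess G u v
    - #|part X i|%:R * (y%:R / r%:R) *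
      weighted_row t (fun j => #|part X j|%:R) i| <= (t + 4)%:R * r%:R ^+ 7.
Proof.
move=> it; have := row_dev X it; have := excess_core_sum X it.
set a := \sum_(u in _) _; set b := \sum_(u in _) _; set c := _ * _ * _ => ab bc.
rewrite -(subrKA b) (le_trans (ler_normD _ _)) // (le_trans (lerD ab bc)) //.
rewrite -!natrX -!natrM -natrD ler_nat.
have r4 : (4 <= r)%N by rewrite -mulnA leq_pmulr // muln_gt0 expn_gt0 y_gt0.
have r3 : (2 <= r ^ 3)%N by apply: (@leq_trans (4 ^ 3)) => //; rewrite leq_exp2r.
rewrite (expnD r 3 4 : r ^ 7 = _)%N; move: (r ^ 3)%N (r ^ 4)%N r3 => d f r3; nia.
Qed.

Definition ratio X j : rat := #|part X j|%:R / r%:R ^+ 4.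

Lemma ratio_ge0 X j : 0 <= ratio X j.
Proof. by rewrite divr_ge0 ?exprn_ge0. Qed.

Lemma ratio_le1 X j : ratio X j <= 1.
Proof.
by rewrite ler_pdivrMr ?exprn_gt0 ?ltr0n ?r_gt0 // mul1r -natrX ler_nat card_part.
Qed.

(** Division by [y * r ^ 7] normalizes the main term to the block weights; the error becomes the [e]
    of the lemmas on these weights. *)
Lemma ratio_row X i : (i < t)%N ->
  `|\sum_(u in part X i) \sum_(v in X) excess G u v / (y%:R * r%:R ^+ 7)
    - ratio X i * weighted_row t (ratio X) i| <= (t + 4)%:R / y%:R.
Proof.
move=> /(row_approx X).
have y0 : 0 < y%:R :> rat by rewrite ltr0n y_gt0.
have r0 : 0 < r%:R :> rat by rewrite ltr0n r_gt0.
have -> : weighted_row t (ratio X) i = weighted_row t (fun j => #|part X j|%:R) i / r%:R ^+ 4.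
  by rewrite /weighted_row mulr_suml; apply: eq_bigr => j _; rewrite mulrA.
rewrite /ratio; under [X in _ -> `|X - _| <= _]eq_bigr => u _ do rewrite -mulr_suml.
rewrite -mulr_suml; move: (weighted_row _ _ _) (\sum_(u in _) _) => w s.
move: (#|_|%:R) => c h.
have -> : s / (y%:R * r%:R ^+ 7) - c / r%:R ^+ 4 * (w / r%:R ^+ 4)
  = (s - c * (y%:R / r%:R) * w) / (y%:R * r%:R ^+ 7).
  by move: (r%:R : rat) r0 (y%:R : rat) y0 => R0 R1 Y Y1; field; rewrite !lt0r_neq0.
rewrite normrM [X in _ * X]gtr0_norm ?invr_gt0 ?mulr_gt0 ?exprn_gt0 //.
rewrite ler_pdivrMr ?mulr_gt0 ?exprn_gt0 // [leRHS]mulrA mulfVK ?lt0r_neq0 //.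
Qed.

(** Summing the sign condition over a part gives the row condition of [weighted_row_full] or
    [weighted_row_cofull]; [y_ge1] and [y_ge3] make [e] small enough. *)
Lemma full_card X :
    {in X, forall u, 0 <= \sum_(v in X) excess G u v} \/
    {in X, forall u, \sum_(v in X) excess G u v <= 0} ->
  (\sum_(0 <= i < t) #|part X i| <= 4 * r ^ 4)%N.
Proof.
move=> fX; have y0 : 0 < y%:R :> rat by rewrite ltr0n y_gt0.
have r0 : 0 < r%:R :> rat by rewrite ltr0n r_gt0.
have partX i u : u \in part X i -> u \in X by rewrite inE => /andP[].
have e_ge0 : 0 <= (t + 4)%:R / y%:R :> rat by rewrite divr_ge0.
suff : \sum_(0 <= i < t) ratio X i <= 4%:R.
  rewrite -mulr_suml ler_pdivrMr ?exprn_gt0 // -natr_sum -natrX -natrM ler_nat.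
  by [].
case: fX => fX.
  apply: (weighted_row_full (ratio_ge0 X) (ratio_le1 X) e_ge0).
    by rewrite mulrAC ler_pdivrMr // mul1r -natrM ler_nat y_ge1.
  move=> i it; have := ratio_row X it.
  have s0 : 0 <= \sum_(u in part X i) \sum_(v in X) excess G u v / (y%:R * r%:R ^+ 7).
    apply: sumr_ge0 => u /partX/fX h; rewrite -mulr_suml mulr_ge0 // invr_ge0.
    by rewrite mulr_ge0 ?exprn_ge0.
  by rewrite ler_norml => /andP[_]; move: s0; lra.
apply: (@weighted_row_cofull rat t (ratio X) ((t + 4)%:R / y%:R) (ratio_ge0 X)).
  by rewrite mulrAC ler_pdivrMr // mul1r -natrM ler_nat y_ge3.
move=> i it; have := ratio_row X it.
have s0 : \sum_(u in part X i) \sum_(v in X) excess G u v / (y%:R * r%:R ^+ 7) <= 0.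
  apply: sumr_le0 => u /partX/fX h; rewrite -mulr_suml mulr_le0_ge0 // invr_ge0.
  by rewrite mulr_ge0 ?exprn_ge0.
by rewrite ler_norml => /andP[h _]; move: s0 h; lra.
Qed.

End Graph.

(** * Balancing the density inside the further blocks *)

Definition V0 : {set V} := [set u | t <= blk u]%N.

Definition crossing u v : bool := (blk u < t)%N || (blk v < t)%N.

Lemma crossingE u v : crossing u v = ~~ ((u \in V0) && (v \in V0)).
Proof. by rewrite !inE negb_and -!ltnNge. Qed.

Definition core_rel u v := crossing u v && core u v.

Lemma core_relC : symmetric core_rel.
Proof. by move=> u v; rewrite /core_rel /crossing orbC coreC. Qed.

(** Only the prescribed edges; pairs inside [V0] stay free for correcting the density. *)
Definition rest := graph_of core_rel.

Lemma sum_mu :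
  \sum_(i < t + 3) \sum_(j < t + 3) `|mu i j| <= 2%:R * 16%:R ^+ t.
Proof.
have muE i j : (i < t)%N -> (j < t)%N -> `|mu i j| = 16%:R ^+ (t - maxn i j).
  move=> it jt; rewrite /mu gtn_max it jt /weight /=.
  by case: eqP => [->|_]; rewrite ?maxnn ?normrN normrX normr_nat.
have mu0 i j : (t <= i)%N || (t <= j)%N -> mu i j = 0.
  by rewrite /mu gtn_max !ltnNge; case: (t <= i)%N => //= ->.
rewrite (big_lt_t (f := fun i => \sum_(j < t + 3) `|mu i j|)); last first.
  by move=> i ti; apply: big1 => j _; rewrite mu0 ?ti ?normr0.
apply: le_trans (sum_weight t); apply: ler_sum_nat => i /andP[_ it].
rewrite (big_lt_t (f := fun j => `|mu i j|)); last first.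
  by move=> j tj; rewrite mu0 ?tj ?orbT ?normr0.
by apply: ler_sum_nat => j /andP[_ jt]; rewrite muE.
Qed.

Lemma r_ge : (8 * (t + 4) ^ 3 <= r)%N.
Proof.
have h : (0 < 16 ^ t)%N by rewrite expn_gt0.
apply: leq_trans (leq_pmulr _ h) _; apply: leq_trans y_ge _.
by rewrite leq_pmull // muln_gt0.
Qed.

(** A pair of blocks contributes an error [r ^ 7] and a bias of at most [r ^ 8 * (y / r)] times its
    [mu] in absolute value. As [y / r = 1 / (4 * 16 ^ t)], [sum_mu] bounds the total bias by
    [r ^ 8 / 2]. *)
Lemma core_sum :
  `|\sum_u \sum_v (crossing u v)%:R * ((core u v)%:R - 2^-1)|
    <= (t + 3)%:R ^+ 2 * r%:R ^+ 7 + r%:R ^+ 8 / 2 :> rat.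
Proof.
have y0 : 0 < y%:R :> rat by rewrite ltr0n y_gt0.
have r0 : 0 < r%:R :> rat by rewrite ltr0n r_gt0.
have sumT (f : V -> rat) : \sum_u f u = \sum_(i < t + 3) \sum_(u in part setT i) f u.
  by rewrite -sum_part; apply: eq_bigl => u; rewrite inE.
have -> : \sum_u \sum_v (crossing u v)%:R * ((core u v)%:R - 2^-1)
  = \sum_(i < t + 3) \sum_(j < t + 3) ((i < t) || (j < t))%N%:R *
     \sum_(u in part setT i) \sum_(v in part setT j) ((core u v)%:R - 2^-1) :> rat.
  rewrite sumT; apply: eq_bigr => i _; rewrite (eq_bigr _ (fun u _ => sumT _)) exchange_big.
  apply: eq_bigr => j _; rewrite mulr_sumr; apply: eq_bigr => u ui.
  rewrite mulr_sumr; apply: eq_bigr => v vj.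
  by rewrite /crossing (part_blk ui) (part_blk vj).
have block (i j : 'I_(t + 3)) : `|((i < t) || (j < t))%N%:R *
     \sum_(u in part setT i) \sum_(v in part setT j) ((core u v)%:R - 2^-1)|
    <= r%:R ^+ 7 + r%:R ^+ 8 * (y%:R / r%:R) * `|mu i j| :> rat.
  rewrite normrM normr_nat; set s := \sum_(u in _) _.
  apply: (@le_trans _ _ `|s|); first by case: (_ || _); rewrite ?mul1r ?mul0r.
  have := block_dev (@part_blk setT i) (@part_blk setT j); rewrite -/s.
  set c := _ * _ * _ => sc; rewrite -(subrK c s) (le_trans (ler_normD _ _)) //.
  have yr0 : 0 <= y%:R / r%:R :> rat by rewrite divr_ge0.
  apply: lerD => //; rewrite /c normrM -natrM normr_nat normrM (ger0_norm yr0).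
  rewrite -[leRHS]mulrA; apply: ler_wpM2r; first by rewrite mulr_ge0.
  by rewrite -natrX ler_nat (expnD r 4 4 : r ^ 8 = _)%N leq_mul ?card_part.
have : 0 <= r%:R ^+ 8 :> rat by rewrite exprn_ge0.
move: block; move: (r%:R ^+ 7) (r%:R ^+ 8) => d7 d8 block d80.
apply: le_trans (ler_norm_sum _ _ _) _.
apply: (@le_trans _ _ (\sum_(i < t + 3) \sum_(j < t + 3)
   (d7 + d8 * (y%:R / r%:R) * `|mu i j|))).
  apply: ler_sum => i _; apply: le_trans (ler_norm_sum _ _ _) _.
  by apply: ler_sum => j _; apply: block.
under eq_bigr => i _ do rewrite big_split /= -mulr_sumr sumr_const card_ord.
rewrite big_split /= -mulr_sumr sumr_const card_ord; apply: lerD.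
  by rewrite -mulrnA -[leLHS]mulr_natl natrM expr2.
apply: le_trans (ler_wpM2l _ sum_mu) _; first by rewrite mulr_ge0 // divr_ge0.
rewrite -mulrA ler_wpM2l //.
rewrite mulrAC ler_pdivrMr // !natrM natrX; lra.
Qed.

Lemma card_V0 : (2 * r ^ 4 <= #|V0|)%N.
Proof.
have small : (#|~: V0| <= t * r ^ 4)%N.
  rewrite card_sum_part (big_lt_t (f := fun i => #|part (~: V0) i|)) => [|i ti].
    rewrite -[t in (t * _)%N]subn0 -sum_nat_const_nat.
    by apply: leq_sum => i _; apply: card_part.
  apply/eqP; rewrite cards_eq0 -subset0; apply/subsetP => u.
  by rewrite !inE -ltnNge => /andP[ut /eqP ui]; move: ut; rewrite ui ltnNge ti.
have := V_ge; rewrite -(cardsC V0) mulnDl; move: (t * _)%N (2 * _)%N small; lia.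
Qed.

Lemma card_V_le : (#|V| <= (t + 3) * r ^ 4)%N.
Proof.
rewrite -cardsT card_sum_part -[(t + 3)%N in X in (_ <= X)%N]card_ord -sum_nat_const.
by apply: leq_sum => i _; apply: card_part.
Qed.

Lemma V_le8 : (8 * #|V| <= r ^ 8)%N.
Proof.
rewrite (expnD r 4 4 : r ^ 8 = _)%N; apply: leq_trans (leq_mul (leqnn 8) card_V_le) _.
rewrite mulnA leq_mul2r; apply/orP; right; apply: (@leq_trans r).
  apply: leq_trans r_ge; rewrite leq_mul2l /=; apply: (@leq_trans (t + 4)).
    by rewrite leq_add2l.
  by rewrite -[leqLHS]expn1 leq_pexp2l ?addn_gt0 ?orbT.
by rewrite -[leqLHS]expn1 leq_pexp2l ?r_gt0.
Qed.

(** The bias in [core_sum] costs [r ^ 8 / 2], its [r ^ 7] term and the diagonal pairs [r ^ 8 / 8]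
    each. *)
Lemma edges_rest : `|(2 * #|edges rest|)%:R - (#|V|%:R ^+ 2 - #|V0|%:R ^+ 2) / 2|
   <= 3%:R / 4%:R * r%:R ^+ 8 :> rat.
Proof.
have crossing_sum : \sum_u \sum_v (crossing u v)%:R = #|V|%:R ^+ 2 - #|V0|%:R ^+ 2 :> rat.
  have cE u v : (crossing u v)%:R = 1 - (u \in V0)%:R * (v \in V0)%:R :> rat.
    by rewrite crossingE; case: (u \in V0); case: (v \in V0);
      rewrite /= ?mulr0 ?mul0r ?subr0 ?mulr1 ?subrr.
  have inV0 : \sum_u (u \in V0)%:R = #|V0|%:R :> rat.
    by rewrite -natr_sum -sum1_card [in RHS]big_mkcond.
  under eq_bigr => u _ do rewrite (eq_bigr _ (fun v _ => cE u v)) sumrB sumr_const -mulr_sumr inV0.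
  by rewrite sumrB sumr_const -mulr_suml inV0 !expr2 -[X in X - _]mulr_natl.
have -> : (2 * #|edges rest|)%:R = \sum_u \sum_v (crossing u v)%:R * ((core u v)%:R - 2^-1)
   + \sum_u \sum_v (crossing u v)%:R / 2 - \sum_u (crossing u u && core u u)%:R :> rat.
  rewrite -sum_adj natr_sum -!big_split -sumrB /=; apply: eq_bigr => u _.
  rewrite natr_sum (bigD1 u) //= adjxx [in RHS](bigD1 u) //= [X in _ + X - _](bigD1 u) //=.
  rewrite add0r.
  have -> : \sum_(i | i != u) (adj rest u i)%:R
    = \sum_(i | i != u) (crossing u i)%:R * ((core u i)%:R - 2^-1)
     + \sum_(i | i != u) (crossing u i)%:R / 2 :> rat.
    rewrite -big_split; apply: eq_bigr => v vu; rewrite (adj_graph_of _ _ core_relC).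
    by rewrite eq_sym vu /core_rel; case: crossing; case: core => /=; lra.
  by case: crossing; case: core => /=; lra.
have -> : \sum_u \sum_v (crossing u v)%:R / 2 = (#|V|%:R ^+ 2 - #|V0|%:R ^+ 2) / 2 :> rat.
  by rewrite -crossing_sum mulr_suml; apply: eq_bigr => u _; rewrite mulr_suml.
have d_ge0 : 0 <= \sum_u (crossing u u && core u u)%:R :> rat by apply: sumr_ge0.
have d_le : \sum_u (crossing u u && core u u)%:R <= #|V|%:R :> rat.
  by rewrite -natr_sum ler_nat -sum1_card; apply: leq_sum => u _; case: (_ && _).
have V_le : #|V|%:R <= r%:R ^+ 8 / 8%:R :> rat.
  by rewrite ler_pdivlMr // -natrX -natrM ler_nat mulnC V_le8.
have t_le : (t + 3)%:R ^+ 2 * r%:R ^+ 7 <= r%:R ^+ 8 / 8%:R :> rat.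
  rewrite ler_pdivlMr // -!natrX -!natrM ler_nat mulnAC (expnD r 1 7 : r ^ 8 = _)%N.
  apply: leq_mul => //; rewrite expn1; apply: leq_trans r_ge; rewrite mulnC leq_mul2l /=.
  by apply: (@leq_trans ((t + 4) ^ 2)); rewrite ?leq_exp2r ?leq_pexp2l ?addn_gt0 ?orbT ?leq_add2l.
have := core_sum; set c := \sum_u \sum_v _; set d := \sum_u _ in d_ge0 d_le *.
move=> c_le; have -> : c + (#|V|%:R ^+ 2 - #|V0|%:R ^+ 2) / 2 - d
    - (#|V|%:R ^+ 2 - #|V0|%:R ^+ 2) / 2
  = c - d by ring.
apply: le_trans (ler_normB _ _) _; rewrite (ger0_norm d_ge0).
by move: t_le V_le d_le c_le; lra.
Qed.

Lemma mul2_bin n : (2 * 'C(n, 2) = n.-1 * n)%N.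
Proof. by rewrite mul_bin_left bin1 subn1. Qed.

(** Half of the ordered pairs inside [V0] number at least [2 * r ^ 8], which outweighs the error of
    [edges_rest] and the linear terms; so an empty [V0] gives too few edges and a complete one
    enough. *)
Lemma half_range :
  (#|edges rest| <= 'C(#|V|, 2)./2 <= #|edges rest| + 'C(#|V0|, 2))%N.
Proof.
have := edges_rest; have V8 : #|V|%:R * 8%:R <= r%:R ^+ 8 :> rat.
  by rewrite -natrX -natrM ler_nat mulnC V_le8.
have Q1 : 1 <= r%:R ^+ 4 :> rat by rewrite exprn_ege1 ?ler1n ?r_gt0.
have V0_ge : 2%:R * r%:R ^+ 4 <= #|V0|%:R :> rat.
  by rewrite -natrX -natrM ler_nat card_V0.
have V0_le : #|V0|%:R <= #|V|%:R :> rat by rewrite ler_nat max_card.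
have bV n : (0 < n)%N -> 2%:R * 'C(n, 2)%:R = n%:R ^+ 2 - n%:R :> rat.
  move=> n0; rewrite -natrM mul2_bin natrM -subn1 natrB // mulrBl mul1r expr2 //.
have V_gt0 : (0 < #|V|)%N by apply: ltnW V_gt1.
have V0_gt0 : (0 < #|V0|)%N by apply: leq_trans card_V0; rewrite muln_gt0 expn_gt0 r_gt0.
have h1 := bV _ V_gt0; have h2 := bV _ V0_gt0; rewrite natrM ler_norml => /andP[lo hi].
have e8 : r%:R ^+ 8 = (r%:R ^+ 4) ^+ 2 :> rat by rewrite -exprM.
suff : (2 * #|edges rest| < 'C(#|V|, 2))%N /\
    ('C(#|V|, 2) <= 2 * (#|edges rest| + 'C(#|V0|, 2)))%N.
  by move=> [? ?]; lia.
rewrite -(ltr_nat rat) -(ler_nat rat) !natrM natrD.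
move: V8 lo hi; rewrite {}e8; move: (r%:R ^+ 4 : rat) Q1 V0_ge => Q Q1 V0_ge.
move: (#|edges rest|%:R : rat) ('C(#|V|, 2)%:R : rat) h1 => e P h1.
move: ('C(#|V0|, 2)%:R : rat) h2 => P0 h2.
move: (#|V|%:R : rat) (#|V0|%:R : rat) h1 h2 V0_ge V0_le => n m h1 h2 V0_ge V0_le V8 lo hi.
have Q2 : 1 <= Q ^+ 2 by rewrite exprn_ege1.
have m2 : 0 <= (m - 2%:R * Q) * m by apply: mulr_ge0; lra.
have mQ : 0 <= (m - 2%:R * Q) * Q by apply: mulr_ge0; lra.
have m3 : 0 <= m * (Q - 1) by apply: mulr_ge0; lra.
by split; lra.
Qed.

Lemma exists_balanced : exists2 G : sgraph V,
  forall u v, u != v -> (blk u < t)%N || (blk v < t)%N -> adj G u v = core u v &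
  `|density G - 2^-1| * #|V|%:R <= 2^-1.
Proof.
pose P0 := [set e : {set V} | (e \subset V0) && (#|e| == 2)].
have /andP[rest_le le_rest] := half_range.
pose k := ('C(#|V|, 2)./2 - #|edges rest|)%N.
have kP : (k <= #|P0|)%N by rewrite cards_draws leq_subLR.
have sP0 := subsetP (take_set_sub P0 k).
have sG : [forall e in edges rest :|: take_set P0 k, #|e| == 2].
  apply/forall_inP => e; rewrite inE => /orP[/(forall_inP (edgesP _))//|/sP0].
  by rewrite inE => /andP[].
exists (SGraph sG) => [u v uv cross|].
  rewrite /adj !in_setU -/(adj rest u v) (adj_graph_of _ _ core_relC) uv /core_rel.
  rewrite [crossing u v]cross /=; case: (boolP (_ \in take_set _ _)); last by rewrite orbF.
  move/sP0; rewrite inE subUset !sub1set => /andP[/andP[uV vV] _].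
  by move: cross; rewrite -/(crossing u v) crossingE uV vV.
have cardE : #|edges rest :|: take_set P0 k| = 'C(#|V|, 2)./2.
  rewrite cardsU (_ : _ :&: _ = set0); first by rewrite cards0 subn0 card_take_set // subnKC.
  apply/eqP; rewrite -subset0; apply/subsetP => e; rewrite inE => /andP[eR /sP0].
  rewrite inE => /andP[/subsetP eV /cards2P[u [v [uv def_e]]]].
  have : adj rest u v by rewrite /adj -def_e.
  by rewrite (adj_graph_of _ _ core_relC) /core_rel crossingE !eV ?andbF // def_e !inE eqxx ?orbT.
rewrite /density /= cardE; set P := 'C(_, 2).
have P_gt0 : (0 < P)%N by rewrite bin_gt0 V_gt1.
(* Rounding moves the number of edges by at most 1/2 from half of [P]; this suffices because
   [#|V| <= P], which holds from three vertices on. *)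
have V3 : (3 <= #|V|)%N.
  apply: leq_trans V_ge; apply: (@leq_trans (2 * 2 ^ 4)) => //.
  apply: leq_mul; rewrite ?leq_addl // leq_exp2r //; apply: leq_trans r_ge.
  by rewrite -[2%N]muln1 leq_mul ?expn_gt0 ?addn_gt0 ?orbT.
have nP : (#|V| <= P)%N by have := mul2_bin #|V|; rewrite -/P; nia.
have P0' : 0 < P%:R :> rat by rewrite ltr0n.
have dev : `|P./2%:R / P%:R - 2^-1| * P%:R <= 2^-1 :> rat.
  rewrite -[X in _ * X]gtr0_norm // -normrM mulrBl divfK ?lt0r_neq0 //.
  have := odd_double_half P; move: (P./2) (odd P) => h b <-.
  by rewrite -muln2 natrD natrM ler_norml; case: b => /=; lra.
by apply: le_trans dev; rewrite ler_wpM2l // ler_nat.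
Qed.

(** The first [t] blocks contribute at most [4 * r ^ 4] vertices by [full_card], the remaining three
    at most [r ^ 4] each. *)
Lemma exists_small_gG : exists G : sgraph V, (gG G <= 7 * r ^ 4)%N.
Proof.
have [G adjG densG] := exists_balanced; exists G.
suff bound X : {in X, forall u, 0 <= \sum_(v in X) excess G u v} \/
    {in X, forall u, \sum_(v in X) excess G u v <= 0} -> (#|X| <= 7 * r ^ 4)%N.
  rewrite gGE geq_max; apply/andP; split; apply: fG_leq => X.
    by move/full_inducedP => fX; apply: bound; left.
  by move/(full_compl_inducedP _ _ V_gt1) => fX; apply: bound; right.
move/(full_card adjG densG) => le4; rewrite card_sum_part.
rewrite -(big_mkord xpredT (fun i => #|part X i|)) (@big_cat_nat _ _ _ t) ?leq_addr //=.
rewrite (_ : 7 = 4 + 3)%N // mulnDl leq_add //.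
apply: (@leq_trans (\sum_(t <= i < t + 3) r ^ 4)); first by apply: leq_sum => i _; apply: card_part.
by rewrite sum_nat_const_nat addKn.
Qed.

End Construction.

(** * Asymptotics *)


Lemma g_le n (G : sgraph 'I_n) : (g n <= gG G)%N.
Proof. by rewrite /g; case: arg_minnP => // H _; apply. Qed.

Lemma g_lower n : (1 < n)%N -> (n <= 144 * (trunc_log 2 n).+1 * g n + 1)%N.
Proof.
by move=> n1; have := @gG_lower 'I_n [arg min_(G < empty_graph 'I_n) gG G]; rewrite card_ord; apply.
Qed.

(** Here [r = 2 ^ k] and the field has order [4 ^ k]. Blocks are runs of [16 ^ k] consecutive
    vertices, and the remainder modulo [16 ^ k] selects the label. *)
Lemma g_upper_param n k t : (8 * (t + 4) ^ 3 * 16 ^ t <= 2 ^ (k - 2 - 4 * t))%N ->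
    (4 * t + 2 <= k)%N -> ((t + 2) * 16 ^ k <= n < (t + 3) * 16 ^ k)%N ->
  (g n <= 7 * 16 ^ k)%N.
Proof.
move=> y_ge tk /andP[n_ge n_lt]; set y := (2 ^ _)%N in y_ge.
have rE : (4 * 16 ^ t * y = 2 ^ k)%N.
  by rewrite -(expnM 2 4 t : (2 ^ (4 * t) = 16 ^ t)%N) -(expnD 2 2) -expnD; congr expn; lia.
have k_gt0 : (0 < k)%N by lia.
have r4 : ((2 ^ k) ^ 4 = 16 ^ k)%N by rewrite -expnM mulnC expnM.
have k2_gt0 : (0 < 2 * k)%N by rewrite muln_gt0.
have [F _ cardF] := pPrimePowerField (isT : prime 2) k2_gt0.
have cardFF : #|{: F * F}| = (16 ^ k)%N.
  by rewrite card_prod cardF -expnD -r4 -expnM; congr expn; lia.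
have Q_gt0 : (0 < 16 ^ k)%N by rewrite expn_gt0.
pose blk (u : 'I_n) := (u %/ 16 ^ k)%N.
pose lab (u : 'I_n) := nth (0, 0) (enum {: F * F}) (u %% 16 ^ k)%N.
have [|||//||G gG_le] := @exists_small_gG 'I_n F t y blk lab.
- by rewrite rE cardF -expnM mulnC.
- by move=> u; rewrite ltn_divLR // (ltn_trans (ltn_ord u)).
- move=> u v uv /eqP; rewrite nth_uniq ?enum_uniq // -?cardE ?cardFF ?ltn_pmod // => /eqP uv'.
  by apply: val_inj; rewrite /= (divn_eq u (16 ^ k)) (divn_eq v (16 ^ k)) uv' [(u %/ _)%N]uv.
- by rewrite card_ord rE r4.
by apply: leq_trans (g_le G) _; rewrite rE r4 in gG_le.
Qed.

(** The constant 1000 keeps [t] below [k / 60], so that the exponents [4 * t] on both sides and the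
    cubic factor fit below [k]; [k >= 2000] guarantees two complete blocks for the further
    vertices. *)
Lemma g_upper n k : (2000 <= k)%N -> (16 ^ k * k <= 1000 * n)%N ->
  (1000 * n < 16 ^ k.+1 * k.+1)%N -> (g n <= 7 * 16 ^ k)%N.
Proof.
move=> k_ge n_ge n_lt; have Q_gt0 : (0 < 16 ^ k)%N by rewrite expn_gt0.
have d_ge : (2 <= n %/ 16 ^ k)%N by rewrite leq_divRL //; nia.
pose t := (n %/ 16 ^ k - 2)%N; have tE : (n %/ 16 ^ k = t + 2)%N by rewrite subnK.
have n1 : ((t + 2) * 16 ^ k <= n)%N by rewrite -tE leq_divM.
have n2 : (n < (t + 3) * 16 ^ k)%N by rewrite (addnS t 2) -tE -ltn_divLR.
have t_le : (1000 * (t + 2) < 16 * k.+1)%N.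
  rewrite -(ltn_pmul2r Q_gt0) -mulnA; apply: leq_ltn_trans (leq_mul (leqnn 1000) n1) _.
  by rewrite mulnAC -expnS.
apply: (@g_upper_param n k t); [|lia|by rewrite n1].
have [e eE] : exists e, e = (k %/ 10)%N by exists (k %/ 10)%N.
have te : (t + 4 <= 2 ^ e)%N.
  by apply: leq_trans (ltnW (ltn_expl e (isT : (1 < 2)%N))); rewrite eE; lia.
have te3 : ((t + 4) ^ 3 <= (2 ^ e) ^ 3)%N by rewrite leq_exp2r.
apply: leq_trans (leq_mul (leq_mul (leqnn 8) te3) (leqnn _)) _.
rewrite (_ : 8 = 2 ^ 3)%N // (_ : 16 = 2 ^ 4)%N // -!expnM -!expnD leq_exp2l //.
by rewrite eE; lia.
Qed.

Lemma exists_scale k0 : exists N : nat, forall n : nat, (N <= n)%N ->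
  exists k, [/\ (k0 <= k)%N, (16 ^ k * k <= 1000 * n)%N & (1000 * n < 16 ^ k.+1 * k.+1)%N].
Proof.
exists (16 ^ k0 * k0)%N => n n_ge; pose P k := (16 ^ k * k <= 1000 * n)%N.
have Pk0 : P k0 by rewrite /P; lia.
have bnd k : P k -> (k <= 1000 * n)%N.
  by apply: leq_trans; rewrite leq_pmull // expn_gt0.
have [k Pk max_k] := ex_maxnP (ex_intro P k0 Pk0) bnd; exists k; split=> //.
  exact: max_k.
by rewrite ltnNge; apply/negP => /max_k; rewrite ltnn.
Qed.

Theorem theorem4 (R : realType) :
  exists c1 c2 : R, 0 < c1 /\ 0 < c2 /\
    exists N : nat, forall n : nat, (N <= n)%N ->
      c1 * (n%:R / ln n%:R) <= (g n)%:R /\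
      (g n)%:R <= c2 * ((n%:R * ln (ln n%:R)) / ln n%:R).
Proof.
have [k0 k0E] : exists k0, k0 = 2000%N by exists 2000%N.
have [N scaleN] := exists_scale k0.
(* [864 = 288 * 3] comes from [n <= 288 * l.+1 * g n] and [l.+1 <= 3 * ln n]; [70 = 7 * 10] from
   [g n <= 7 * 16 ^ k] and [ln n <= 10 * k]; 1000 from the choice of [k]. *)
exists (864%:R^-1), (70%:R * 1000%:R); split; first by rewrite invr_gt0.
split; first by rewrite mulr_gt0 ?ltr0n.
(* From [expR (expR 1)] on, [ln (ln n)] is at least 1, so a bound of order [n / ln n] implies the
   stated upper bound. *)
exists (maxn N (Num.Def.archi_bound (expR (expR 1) : R))) => n.
rewrite geq_max => /andP[/scaleN[k [k_ge n_ge n_lt]] n_large].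
have n_exp : expR (expR 1) <= n%:R :> R.
  have := archi_boundP (ltW (expR_gt0 (expR 1 : R))) => /ltW/le_trans; apply.
  by rewrite ler_nat.
have n_gt0 : 0 < n%:R :> R by apply: lt_le_trans n_exp; apply: expR_gt0.
have ln_n : expR 1 <= ln n%:R :> R.
  by rewrite -[leLHS]expRK ler_ln ?posrE ?expR_gt0.
have ln_gt0 : 0 < ln n%:R :> R by apply: lt_le_trans ln_n; apply: expR_gt0.
have lnln : 1 <= ln (ln n%:R) :> R by rewrite -[leLHS]expRK ler_ln ?posrE ?expR_gt0.
have ln_ge1 : 1 <= ln n%:R :> R.
  by apply: le_trans ln_n; apply: le_trans (expR_ge1Dx _); lra.
have ln2_le : ln 2 <= 1 :> R by have := @le_ln1Dx R 1; rewrite (_ : 1 + 1 = 2) //; apply; lra.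
have ln2_ge : 2^-1 <= ln 2 :> R.
  have := @le_ln1Dx R (- 2^-1); rewrite (_ : 1 + - 2^-1 = 2^-1); last by field.
  by rewrite lnV ?posrE //; lra.
have n_gt1 : (1 < n)%N.
  by rewrite -(ltr_nat R); apply: lt_le_trans n_exp; rewrite expR_gt1 expR_gt0.
split.
  rewrite mulrA ler_pdivrMr //; have := g_lower n_gt1; set l := trunc_log 2 n => n_le.
  have l_le : l%:R <= 2%:R * ln n%:R :> R.
    have : ln (2 ^+ l) <= ln n%:R :> R.
      by rewrite ler_ln ?posrE ?exprn_gt0 // -natrX ler_nat trunc_logP // ltnW.
    rewrite lnXn // -[_ *+ l]mulr_natl => h.
    have : l%:R * 2^-1 <= l%:R * ln 2 :> R by rewrite ler_wpM2l.
    by lra.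
  (* Doubling 144 absorbs the summand 1, as [n > 1]. *)
  have n_le' : n%:R <= 288%:R * (l.+1)%:R * (g n)%:R :> R.
    by rewrite -!natrM ler_nat; clear -n_le n_gt1; lia.
  have l_le' : l.+1%:R <= 3%:R * ln n%:R :> R by rewrite -natr1; lra.
  have : 288%:R * (l.+1)%:R * (g n)%:R <= 288%:R * (3%:R * ln n%:R) * (g n)%:R :> R.
    by rewrite ler_wpM2r // ler_wpM2l.
  by lra.
have k_gt0 : (0 < k)%N by rewrite (leq_trans _ k_ge) // k0E.
have ln_le : ln n%:R <= 10%:R * k%:R :> R.
  have n_le : (n <= 2 ^ (5 * k.+1))%N.
    have k2 : (k.+1 <= 2 ^ k.+1)%N by rewrite ltnW // ltn_expl.
    rewrite expnM (_ : 2 ^ 5 = 16 * 2)%N // expnMn.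
    apply: leq_trans (leq_mul (leqnn _) k2); apply: leq_trans (ltnW n_lt).
    by rewrite leq_pmull.
  have : ln n%:R <= ln (2 ^+ (5 * k.+1)) :> R.
    by rewrite ler_ln ?posrE ?exprn_gt0 // -natrX ler_nat.
  rewrite lnXn // -[_ *+ _]mulr_natl => h; have k1 : 1 <= k%:R :> R by rewrite ler1n.
  have : (5 * k.+1)%:R <= 10%:R * k%:R :> R by rewrite -natrM ler_nat; clear -k_gt0; lia.
  move=> k5; have : (5 * k.+1)%:R * ln 2 <= (5 * k.+1)%:R * 1 :> R by rewrite ler_wpM2l.
  by lra.
have g_le7 : (g n)%:R <= 7%:R * (16 ^ k)%:R :> R.
  by rewrite -natrM ler_nat g_upper // (leq_trans _ k_ge) // k0E.
have Qk : (16 ^ k)%:R * k%:R <= 1000%:R * n%:R :> R by rewrite -!natrM ler_nat.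
apply: (@le_trans _ _ ((70%:R * 1000%:R) * (n%:R / ln n%:R))); last first.
  apply: ler_wpM2l; first by rewrite mulr_ge0.
  apply: ler_wpM2r; first by rewrite invr_ge0 ltW.
  by rewrite ler_peMr // ltW.
rewrite mulrA ler_pdivlMr //; apply: le_trans (ler_wpM2r (ltW ln_gt0) g_le7) _.
have Q0 : 0 <= (16 ^ k)%:R :> R by [].
have : 7%:R * (16 ^ k)%:R * ln n%:R <= 7%:R * (16 ^ k)%:R * (10%:R * k%:R) :> R.
  by rewrite ler_wpM2l // mulr_ge0.
by lra.
Qed.
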